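(* There is a randomized $O(1)$-round algorithm in the Massively Parallel Communication (MPC) model that, given an $n$-vertex graph $G$, outputs a proper $(\kappa(G)+o(\kappa(G)))$-coloring of $G$ with high probability. The algorithm uses $n$ processors, each with $O(n\log^2 n)$ bits of memory.
   Context: In the MPC model, the input (here the edge set of $G$) is distributed adversarially among processors, each with a bounded number $S$ of bits of memory; computation proceeds in synchronous rounds in which each processor performs arbitrary local computation and then communicates with any other processors, subject to each processor sending and receiving at most $S$ bits per round. $\kappa(G)$ is the degeneracy of $G$ (least $k$ such that every induced subgraph has a vertex of degree at most $k$). High probability means at least $1-1/\mathrm{poly}(n)$. *)

(* Defs.v *)
From mathcomp Require Import all_boot all_order all_algebra.

Set Implicit Arguments.
Unset Strict Implicit.
Unset Printing Implicit Defensive.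

(* Simple graphs are symmetric irreflexive relations on a finite type. *)

Definition induced_degree (T : finType) (e : rel T) (A : {set T}) (v : T) : nat :=
  #|[set u in A | e v u]|.

Definition degenerate (T : finType) (e : rel T) : pred nat := fun k =>
  [forall A : {set T}, (A != set0) ==>
     [exists v in A, induced_degree e A v <= k]].

Lemma degenerate_ex (T : finType) (e : rel T) : exists k, degenerate e k.
Proof.
exists #|T|; apply/forallP => A; apply/implyP => /set0Pn [v vA].
by apply/existsP; exists v; rewrite vA max_card.
Qed.

Definition degeneracy (T : finType) (e : rel T) : nat :=
  ex_minn (degenerate_ex e).

Definition proper_coloring (T : finType) (e : rel T) (K : nat)
    (chi : {ffun T -> 'I_K}) : bool :=
  [forall u, forall v, e u v ==> (chi u != chi v)].

Definition little_o_id (f : nat -> nat) : Prop :=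
  forall eps : rat, (0 < eps)%R ->
    exists k0 : nat, forall k : nat, k0 <= k ->
      ((f k)%:R <= eps * k%:R)%R.

(* The ceiling of log_2 n, which is also the bit length of a vertex name. *)
Definition lg (n : nat) : nat := up_log 2 n.

Definition vertex_code (n : nat) (v : 'I_n) : seq bool :=
  mkseq (fun j => odd (v %/ 2 ^ j)) (lg n).

Definition edges_code (n : nat) (s : seq ('I_n * 'I_n)) : seq bool :=
  flatten [seq vertex_code uv.1 ++ vertex_code uv.2 | uv <- s].

(* Each edge {u, v} is listed exactly once overall, by one processor, in one of
   its two orientations; nothing else is listed. *)
Definition edge_distribution (n p : nat) (e : rel 'I_n)
    (inp : 'I_p -> seq ('I_n * 'I_n)) : Prop :=
  forall u v : 'I_n,
    \sum_(q < p) (count_mem (u, v) (inp q) + count_mem (v, u) (inp q))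
      = (e u v : nat).

Record local_view (p : nat) := LocalView {
  kept : seq bool;
  inbox : 'I_p -> seq bool
}.

Definition total_size (p : nat) (m : 'I_p -> seq bool) : nat :=
  \sum_(q < p) size (m q).

Definition view_size (p : nat) (x : local_view p) : nat :=
  size (kept x) + total_size (inbox x).

(* An R-round algorithm on p processors, for inputs on the vertex set 'I_n.  In
   each round a processor draws fresh private coins, computes what it keeps in
   memory and the message for every processor.  After the last round processor
   q writes the color [mpc_out q x v], if any, for each vertex v. *)
Record mpc_algorithm (n p R : nat) := MPCAlgorithm {
  coin_len : nat;
  mpc_step : 'I_R -> 'I_p -> local_view p -> coin_len.-tuple bool ->
             seq bool * ('I_p -> seq bool);
  mpc_out : 'I_p -> local_view p -> 'I_n -> option nat
}.

Section Execution.

Variables (n p R : nat) (A : mpc_algorithm n p R).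
Variable inp : 'I_p -> seq ('I_n * 'I_n).

Definition coins := {ffun 'I_R * 'I_p -> (coin_len A).-tuple bool}.

Definition config := 'I_p -> local_view p.

Definition mpc_init : config :=
  fun q => LocalView (edges_code (inp q)) (fun=> [::]).

Definition local_result (w : coins) (r : 'I_R) (x : config) (q : 'I_p) :=
  mpc_step r q (x q) (w (r, q)).

Definition mpc_round (w : coins) (x : config) (r : 'I_R) : config :=
  fun q => LocalView (local_result w r x q).1
                     (fun s => (local_result w r x s).2 q).

Definition config_at (w : coins) (t : nat) : config :=
  foldl (mpc_round w) mpc_init (take t (enum 'I_R)).

(* The bound on [view_size] covers the kept bits together with the bits just
   received. *)
Definition within_memory (S : nat) : Prop :=
  forall w : coins,
    (forall (t : nat) (q : 'I_p), t <= R -> view_size (config_at w t q) <= S) /\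
    (forall (r : 'I_R) (q : 'I_p),
       total_size (local_result w r (config_at w r) q).2 <= S).

Definition mpc_result (w : coins) (q : 'I_p) (v : 'I_n) : option nat :=
  mpc_out A q (config_at w R q) v.

Definition outputs (w : coins) (K : nat) (chi : {ffun 'I_n -> 'I_K}) : bool :=
  [forall v, [exists q, mpc_result w q v == Some (val (chi v))]
          && [forall q, (mpc_result w q v == None)
                     || (mpc_result w q v == Some (val (chi v)))]].

Definition outputs_proper_coloring (e : rel 'I_n) (K : nat) : pred coins :=
  fun w => [exists chi : {ffun 'I_n -> 'I_K},
              outputs w chi && proper_coloring e chi].

Definition mpc_probability (E : pred coins) : rat :=
  (#|[set w : coins | E w]|%:R / #|{: coins}|%:R)%R.

End Execution.

Definition memory_bits (C n : nat) : nat := C * (n * lg n ^ 2).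

(* Main.v *)
Require Import Defs.
From mathcomp Require Import all_boot all_order all_algebra.
From mathcomp Require Import zify ring lra.

(** Write [k] for the degeneracy and [L] for [log n], and fix an order in which
    every vertex has at most [k] earlier neighbors.  Every processor broadcasts
    [O(L^2)] random bits, so that each vertex has a public seed, and all scales
    [2 ^ i] are tried in parallel as estimates of [k].  At a scale, the seeds
    split the vertices into blocks and give each vertex a list of allowed colors;
    the leader of a block receives the edges of the block whose ends have
    intersecting lists and finds a list coloring with fewest colors.  The
    coloring is proper whatever [k] is, and the scale with the fewest colors wins.

    The excess must be [o(k)] uniformly in [n]; let [l = log log n].
    - If [k <= 2 ^ l], one leader can hold the whole graph.
    - If [k > 2 ^ (4 l)], random blocks of mean degree about [L ^ 2] have
      degeneracy at most [1 + O(1 / l)] times the mean.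
    - In between, concentration fails at precision [1 + o(1)], since the blocks
      that fit into the memory have degree [O(L)] only.  Instead a single leader
      colors greedily from [k (1 + 1 / l)] colors, each vertex using only
      [20 l ^ 2] random ones.  Conditionally on the past a vertex gets stuck with
      probability at most [2 ^ (- 5 l)], so every vertex has [O(L / l)] earlier
      neighbors that are stuck, and a reserve of [O(L / l)] colors suffices for
      these.  To keep the number of relevant edges at [O(n L)], the vertices are
      split at random into [k / L] groups with disjoint reserves, which costs only
      [O(k / l)] further colors. *)

Import Order.TTheory GRing.Theory Num.Theory.

Set Implicit Arguments.
Unset Strict Implicit.
Unset Printing Implicit Defensive.

(** * Tail bounds on product spaces *)

Section ProductSpace.

Variables (J T V : finType) (pos : V -> J) (rk : V -> nat).
Hypothesis T_gt0 : 0 < #|T|.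
Hypothesis rk_inj : injective rk.

Local Notation space := {ffun J -> T}.

(** The seed of a vertex [v] sits at the coordinate [pos v]. In the application [J] consists of the
    pairs of a round and a processor, and only the coordinates of the first round carry seeds. *)
Definition resample (w : space) (v : J) (t : T) : space :=
  [ffun u => if u == v then t else w u].

Local Open Scope ring_scope.

(** Exchanging [t] with the value at [v] is an involution of the pairs [(w, t)], so redrawing one
    coordinate preserves the uniform measure. *)
Lemma sum_resample (F : space -> rat) (v : J) :
  \sum_w \sum_t F (resample w v t) = #|T|%:R * \sum_w F w.
Proof.
rewrite pair_big /=.
pose h (p : space * T) := (resample p.1 v p.2, p.1 v).
have hK : involutive h.
  case=> w t; rewrite /h /=; congr (_, _); last by rewrite ffunE eqxx.
  by apply/ffunP => u; rewrite !ffunE; case: eqP => // ->.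
rewrite (reindex_inj (inv_inj hK)) /=.
rewrite (eq_bigr (fun p : space * T => F p.1)); last first.
  move=> [w t] _ /=; congr F; apply/ffunP => u; rewrite !ffunE.
  by case: eqP => // ->.
rewrite -(pair_big xpredT xpredT (fun w (t : T) => F w)) /= mulr_sumr.
by apply: eq_bigr => w _; rewrite sumr_const mulr_natl.
Qed.

(** Adaptedness to the order [rk]: redrawing the seed of a later vertex does not affect [G u].
    Coordinates outside the image of [pos] are not constrained. *)
Definition nonanticipating (A : Type) (G : V -> space -> A) :=
  forall u v w t, (rk u < rk v)%N -> G u (resample w (pos v) t) = G u w.

(** This replaces independence: among the factors, only that of the last vertex of [S] can depend on
    the seed of that vertex, so it is averaged first with the others held fixed. *)
Lemma sum_prod_le (G : V -> space -> rat) (c : V -> rat) (S : {set V}) :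
  (forall v w, 0 <= G v w) -> (forall v, 0 <= c v) -> nonanticipating G ->
  (forall v w, \sum_t G v (resample w (pos v) t) <= #|T|%:R * c v) ->
  \sum_w \prod_(v in S) G v w <= #|{: space}|%:R * \prod_(v in S) c v.
Proof.
move=> G0 c0 locG avgG; move: {2}_.+1 (ltnSn #|S|) => k.
elim: k S => // k IH S; rewrite ltnS => leSk.
have [->|/set0Pn [v0 v0S]] := eqVneq S set0.
  rewrite [X in _ <= _ * X]big_set0 mulr1 (eq_bigr (fun=> 1)) ?sumr_const //.
  by move=> w _; rewrite big_set0.
case: (arg_maxnP rk v0S) => v vS vmax; have {}vS : v \in S := vS.
have T0 : 0 < #|T|%:R :> rat by rewrite ltr0n.
rewrite -(ler_pM2l T0) -(sum_resample _ (pos v)).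
have -> : \sum_w \sum_t \prod_(u in S) G u (resample w (pos v) t) =
    \sum_w (\sum_t G v (resample w (pos v) t)) * \prod_(u in S :\ v) G u w.
  apply: eq_bigr => w _; rewrite mulr_suml; apply: eq_bigr => t _.
  rewrite (big_setD1 v) //=; congr (_ * _).
  apply: eq_bigr => u; rewrite !inE => /andP [uv uS]; apply: locG.
  by rewrite ltn_neqAle (inj_eq rk_inj) uv; apply: vmax.
apply: (@le_trans _ _ (\sum_w #|T|%:R * c v * \prod_(u in S :\ v) G u w)).
  by apply: ler_sum => w _; apply: ler_wpM2r (avgG _ _); apply: prodr_ge0.
rewrite -mulr_sumr -mulrA ler_pM2l // (big_setD1 v vS) /= mulrCA.
apply: ler_wpM2l => //; apply: IH.
by move: leSk; rewrite (cardsD1 v) vS.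
Qed.

(* Markov's inequality for the j-th factorial moment of the number of events that occur. *)
Lemma factorial_tail (ev : V -> space -> bool) (c : rat) (A : {set V}) (m j : nat) :
  0 <= c -> nonanticipating ev ->
  (forall v w, #|[set t | ev v (resample w (pos v) t)]|%:R <= #|T|%:R * c) ->
  #|[set w | (m <= #|[set u in A | ev u w]|)%N]|%:R * (m ^_ j)%:R
    <= #|{: space}|%:R * (#|A|%:R * c) ^+ j.
Proof.
move=> c0 locE avgE.
pose X w := #|[set u in A | ev u w]|.
have sumX : \sum_w ('C(X w, j))%:R <= #|{: space}|%:R * ('C(#|A|, j)%:R * c ^+ j).
  pose D := [set S : {set V} | S \subset A & #|S| == j].
  (* The binomial counts the [j]-subsets of [A] all of whose events occur; [sum_prod_le] bounds the
     probability of each of them by [c ^+ j]. *)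
  have -> : \sum_w ('C(X w, j))%:R =
      \sum_w \sum_(S in D) \prod_(u in S) (ev u w)%:R :> rat.
    apply: eq_bigr => w _; rewrite -cards_draws -sum1_card natr_sum.
    rewrite [in RHS](bigID (fun S : {set V} => S \subset [set u in A | ev u w])) /=.
    rewrite [X in _ + X]big1 ?addr0; last first.
      move=> S /andP [] ; rewrite inE => /andP [/subsetP SA _] /subsetPn [u uS].
      rewrite !inE SA //= => /negbTE evu.
      by rewrite (bigD1 u) //= evu mul0r.
    apply: eq_big => [S|S].
      rewrite !inE; case: (boolP (S \subset [set u in A | ev u w])) => //=.
        move=> sub; rewrite (subset_trans sub) ?andbT //.
        by apply/subsetP => u; rewrite inE => /andP [].
      by rewrite andbF.
    rewrite inE => /andP [/subsetP sub _]; rewrite big1 // => u /sub.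
    by rewrite inE => /andP [_ ->].
  rewrite exchange_big /=.
  apply: (@le_trans _ _ (\sum_(S in D) #|{: space}|%:R * c ^+ j)); last first.
    by rewrite sumr_const cards_draws mulrCA [X in _ <= X]mulr_natl lexx.
  apply: ler_sum => S; rewrite inE => /andP [_ /eqP <-].
  have := @sum_prod_le (fun u w => (ev u w)%:R) (fun=> c) S.
  rewrite prodr_const; apply=> // [u v w t uv|v w].
    by rewrite locE.
  apply: le_trans (avgE v w); rewrite -natr_sum ler_nat -sum1_card.
  rewrite [X in (_ <= X)%N]big_mkcond /=.
  by apply: leq_sum => t _; rewrite inE; case: (ev _ _).
have step : \sum_w ((X w) ^_ j)%:R <= #|{: space}|%:R * ((#|A| ^_ j)%:R * c ^+ j).
  rewrite (eq_bigr (fun w => j`!%:R * ('C(X w, j))%:R)); last first.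
    by move=> w _; rewrite -bin_ffact natrM mulrC.
  rewrite -mulr_sumr -bin_ffact natrM.
  apply: le_trans (ler_wpM2l (ler0n _ j`!) sumX) _.
  by rewrite le_eqVlt; apply/orP; left; apply/eqP; ring.
(* Markov: where [m <= X w], the falling factorial of [X w] is at least that of [m]. *)
apply: le_trans (le_trans step _).
  rewrite -sum1_card natr_sum mulr_suml [X in _ <= X](bigID (fun w => m <= X w)%N) /=.
  apply: ler_wpDr; first by apply: sumr_ge0.
  rewrite (eq_bigl (fun w => m <= X w)%N); last by move=> w; rewrite inE.
  apply: ler_sum => w mX; rewrite mul1r ler_nat.
  by rewrite -!bin_ffact leq_mul2r leq_bin2l ?orbT.
rewrite exprMn; apply: ler_wpM2l => //; apply: ler_wpM2r; first exact: exprn_ge0.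
rewrite -natrX ler_nat.
elim: (j) => [|k IHk]; first by rewrite ffactn0 expn0.
by rewrite ffactnSr expnSr leq_mul // leq_subr.
Qed.

Lemma factorial_tail_nat (ev : V -> space -> bool) (D m j : nat) (A : {set V}) :
  (0 < D)%N -> nonanticipating ev ->
  (forall v w, (#|[set t | ev v (resample w (pos v) t)]| * D <= #|T|)%N) ->
  (#|[set w | (m <= #|[set u in A | ev u w]|)%N]| * (m ^_ j * D ^ j)
    <= #|{: space}| * #|A| ^ j)%N.
Proof.
move=> D0 locE avgE.
have D0r : 0 < D%:R :> rat by rewrite ltr0n.
have avgr v w : #|[set t | ev v (resample w (pos v) t)]|%:R <= #|T|%:R * D%:R^-1 :> rat.
  by rewrite ler_pdivlMr // -natrM ler_nat.
have c0 : 0 <= D%:R^-1 :> rat by rewrite invr_ge0 ltW.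
have := factorial_tail A m j c0 locE avgr.
rewrite exprMn exprVn mulrA ler_pdivlMr ?exprn_gt0 //.
by rewrite -!natrX -!natrM ler_nat mulnA.
Qed.

Lemma bernoulli (y : rat) (m : nat) : 0 <= y -> 1 + m%:R * y <= (1 + y) ^+ m.
Proof.
move=> y0; elim: m => [|m IH]; first by rewrite mul0r addr0 expr0.
rewrite exprS; have := ler_wpM2l (addr_ge0 ler01 y0) IH; apply: le_trans.
rewrite -natr1; have := mulr_ge0 (mulr_ge0 (ler0n rat m) y0) y0; lra.
Qed.

Lemma bernoulli_upper (y : rat) (m : nat) :
  0 <= y -> m%:R * y <= 1 / 2%:R -> (1 + y) ^+ m <= 1 + 2%:R * (m%:R * y).
Proof.
move=> y0; elim: m => [|m IH] hm; first by rewrite expr0 mul0r mulr0 addr0.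
have m0 := ler0n rat m.
have hm1 : m%:R * y + y <= 1 / 2%:R by move: hm; rewrite -natr1 mulrDl mul1r.
have {}IH := IH ltac:(lra).
rewrite exprS; have := ler_wpM2l (addr_ge0 ler01 y0) IH.
move/le_trans; apply; rewrite -natr1.
have := mulr_ge0 m0 y0; nra.
Qed.

(** Chernoff's method with powers of [1 + y] as exponentials. Each factor averages to at most
    [(1 + y) ^+ (2 * mu)], so Markov at [4 * mu * #|V|] gains [(1 + y) ^+ (2 * mu * #|V|)], which is
    at least [2 ^ a]. *)
Lemma exponential_tail (X : V -> space -> nat) (k mu a : nat) :
  (0 < k)%N -> (a * k <= mu * #|V|)%N -> nonanticipating X ->
  (forall v w, (X v w <= k)%N) ->
  (forall v w, (\sum_t X v (resample w (pos v) t) <= #|T| * mu)%N) ->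
  (#|[set w | (4 * mu * #|V| <= \sum_v X v w)%N]| * 2 ^ a <= #|{: space}|)%N.
Proof.
move=> k0 hak locX leXk avgX.
(* This [y] keeps [y] times [X] at most 1/2, as [bernoulli_upper] demands, while
   [(1 + y) ^+ (2 * k)] is still at least 2. *)
pose y : rat := (2 * k)%:R^-1.
have y0 : 0 < y by rewrite invr_gt0 ltr0n muln_gt0.
have ky : k%:R * y = 1 / 2%:R.
  by rewrite /y natrM; field; rewrite pnatr_eq0 -lt0n.
have Ele : \sum_w (1 + y) ^+ (\sum_v X v w) <=
    #|{: space}|%:R * (1 + y) ^+ (2 * mu * #|V|).
  have := @sum_prod_le (fun v w => (1 + y) ^+ X v w)
    (fun=> (1 + y) ^+ (2 * mu)) setT.
  rewrite prodr_const cardsT -exprM (eq_bigr (fun w => (1 + y) ^+ (\sum_v X v w))).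
    apply=> [v w|v|u v w t uv|v w].
    - by rewrite exprn_ge0 // addr_ge0 // ltW.
    - by rewrite exprn_ge0 // addr_ge0 // ltW.
    - by rewrite locX.
    apply: (@le_trans _ _ (\sum_t (1 + 2%:R * y * (X v (resample w (pos v) t))%:R))).
      apply: ler_sum => t _; rewrite -mulrA [y * _]mulrC.
      apply: bernoulli_upper; first exact: ltW.
      by rewrite -ky ler_pM2r // ler_nat.
    rewrite big_split /= sumr_const -mulr_sumr -natr_sum.
    apply: (@le_trans _ _ (#|T|%:R * (1 + (2 * mu)%:R * y))).
      rewrite mulrDr mulr1 lerD2l natrM.
      have : (\sum_t X v (resample w (pos v) t))%:R <= #|T|%:R * mu%:R :> rat.
        by rewrite -natrM ler_nat.
      move/(ler_wpM2l (mulr_ge0 (ler0n rat 2) (ltW y0))).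
      move/le_trans; apply; rewrite le_eqVlt; apply/orP; left; apply/eqP; ring.
    by apply: ler_wpM2l => //; apply: bernoulli; apply: ltW.
  move=> w _; rewrite (big_morph _ (exprD (1 + y)) (expr0 _)).
  by apply: eq_bigl => v; rewrite inE.
have y1 : 1 <= 1 + y by rewrite lerDl ltW.
set E := [set w | _].
have low : #|E|%:R * (1 + y) ^+ (4 * mu * #|V|) <= \sum_w (1 + y) ^+ (\sum_v X v w).
  rewrite (bigID (mem E)) /= ler_wpDr ?sumr_ge0 //.
    by move=> w _; rewrite exprn_ge0 // (le_trans ler01).
  rewrite mulr_natl -sumr_const; apply: ler_sum => w; rewrite inE => hw.
  by rewrite ler_weXn2l.
rewrite -(ler_nat rat) natrM natrX.
have P0 : 0 < (1 + y) ^+ (2 * mu * #|V|) by rewrite exprn_gt0 // (lt_le_trans ltr01).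
rewrite -(ler_pM2r P0); apply: le_trans (le_trans low Ele).
rewrite -mulrA; apply: ler_wpM2l => //.
rewrite (_ : 4 * mu * #|V| = 2 * mu * #|V| + 2 * mu * #|V|)%N; last by lia.
rewrite exprD ler_pM2r //.
apply: (@le_trans _ _ ((1 + y) ^+ (2 * k * a))); last first.
  by rewrite ler_weXn2l //; lia.
rewrite exprM; apply: lerXn2r; rewrite ?nnegrE // ?exprn_ge0 ?addr_ge0 ?(ltW y0) //.
have := bernoulli (2 * k) (ltW y0); apply: le_trans.
by rewrite /y divff // pnatr_eq0 -lt0n muln_gt0.
Qed.

End ProductSpace.

(** * The protocol *)

Lemma lg_gt0 n : 1 < n -> 0 < lg n.
Proof. by move=> n1; rewrite /lg up_log_gt0. Qed.

Lemma leq_exp_lg n : n <= 2 ^ lg n.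
Proof. exact: up_logP. Qed.

Lemma bits_inj k a b : a < 2 ^ k -> b < 2 ^ k ->
  (forall j, j < k -> odd (a %/ 2 ^ j) = odd (b %/ 2 ^ j)) -> a = b.
Proof.
elim: k a b => [|k IH] a b; first by rewrite expn0 !ltnS !leqn0 => /eqP -> /eqP ->.
rewrite expnS => ha hb hab.
have /= := hab 0 isT; rewrite !expn0 !divn1 => o.
have e2 : a %/ 2 = b %/ 2.
  apply: IH => [||j jk]; rewrite ?ltn_divLR ?[_ * 2]mulnC //.
  by rewrite -!divnMA -expnS; apply: hab.
by rewrite (divn_eq a 2) (divn_eq b 2) e2 !modn2 o.
Qed.

Lemma vertex_code_inj n : injective (@vertex_code n).
Proof.
move=> u v euv; apply: val_inj => /=.
apply: (@bits_inj (lg n)) => [||j jn].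
- exact: leq_trans (ltn_ord u) (leq_exp_lg n).
- exact: leq_trans (ltn_ord v) (leq_exp_lg n).
by have := congr1 (fun s => nth false s j) euv; rewrite !nth_mkseq.
Qed.

Lemma leq_expn2r_weak k a b : a <= b -> a ^ k <= b ^ k.
Proof. by case: k => // k ab; rewrite leq_exp2r. Qed.

(** * Binary codes of vertex lists and of finite types *)

Section VertexLists.

Variable n : nat.

Definition vertices_code (s : seq 'I_n) : seq bool :=
  flatten [seq vertex_code v | v <- s].

Definition decode_vertices (b : seq bool) : seq 'I_n :=
  pmap (fun c => [pick v | vertex_code v == c])
       (reshape (nseq (size b %/ lg n) (lg n)) b).

Lemma size_vertices_code s : size (vertices_code s) = size s * lg n.
Proof.
elim: s => //= v s IH.
by rewrite /vertices_code /= size_cat size_mkseq -/(vertices_code s) IH mulSn.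
Qed.

Lemma vertices_codeK : 0 < lg n -> cancel vertices_code decode_vertices.
Proof.
move=> lg0 s; rewrite /decode_vertices size_vertices_code mulnK //.
have -> : nseq (size s) (lg n) = shape [seq vertex_code v | v <- s].
  by elim: s => //= v s ->; rewrite size_mkseq.
rewrite flattenK map_pK // => v; case: pickP => [u /eqP|/(_ v)]; last by rewrite eqxx.
by move/vertex_code_inj=> ->.
Qed.

Fixpoint pairs (T : Type) (s : seq T) : seq (T * T) :=
  if s is x :: y :: s' then (x, y) :: pairs s' else [::].

Lemma edges_codeK : 0 < lg n ->
  forall s : seq ('I_n * 'I_n), pairs (decode_vertices (edges_code s)) = s.
Proof.
move=> lg0 s.
have -> : edges_code s = vertices_code (flatten [seq [:: e.1; e.2] | e <- s]).
  rewrite /vertices_code map_flatten -map_comp /edges_code.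
  by elim: s => //= e s ->; rewrite catA.
rewrite vertices_codeK //.
by elim: s => //= -[u v] s /= ->.
Qed.

Lemma size_edges_code (s : seq ('I_n * 'I_n)) :
  size (edges_code s) = size s * (2 * lg n).
Proof.
elim: s => //= e s IH.
rewrite /edges_code /= !size_cat !size_mkseq -/(edges_code s) IH mulSn; lia.
Qed.

End VertexLists.

Section FiniteCode.

Variables (F : finType) (k : nat).

(** The default word has length [k] too, so message lengths are known without any cardinality bound;
    only decoding needs [2 ^ k] to be large enough. *)
Definition encode (x : F) : seq bool :=
  nth (nseq k false) [seq tval t | t <- enum {: k.-tuple bool}] (enum_rank x).

Definition decode (x0 : F) (b : seq bool) : F :=
  odflt x0 [pick x | encode x == b].

Lemma size_encode x : size (encode x) = k.
Proof.
rewrite /encode; case: (ltnP (enum_rank x) (size (enum {: k.-tuple bool}))) => h.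
  by rewrite (nth_map [tuple of nseq k false]) //; apply: size_tuple.
by rewrite nth_default; [rewrite size_nseq | rewrite size_map].
Qed.

Lemma encodeK x0 : #|F| <= 2 ^ k -> cancel encode (decode x0).
Proof.
move=> cF x; rewrite /decode; case: pickP => [y /eqP|/(_ x)]; last by rewrite eqxx.
rewrite /encode; set l := map _ _ => /eqP.
have szl : size l = 2 ^ k by rewrite size_map -cardE card_tuple card_bool.
have lt_l (z : F) : enum_rank z < size l.
  by rewrite szl; apply: leq_trans (ltn_ord _) cF.
rewrite nth_uniq //; last by rewrite map_inj_uniq ?enum_uniq //; apply: val_inj.
by move/eqP/val_inj/enum_rank_inj => ->.
Qed.

End FiniteCode.

Lemma config_atS n p R (A : mpc_algorithm n p R) inp (w : coins A) t (ht : t < R) :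
  config_at inp w t.+1 = mpc_round w (config_at inp w t) (Ordinal ht).
Proof.
rewrite /config_at (take_nth (Ordinal ht)) ?size_enum_ord // -cats1 foldl_cat /=.
by congr (mpc_round w _ _); apply: val_inj => /=; rewrite nth_enum_ord.
Qed.

(* At scale i a vertex with seed x belongs to the block led by processor
   [home i x] and may only use the colors in [palette i x]; a processor leads a
   block of at most one scale.  Edges inside a block whose end points do not
   [clash] need not be known to the leader. *)
Record scheme (n : nat) := Scheme {
  seed_len : nat;
  scales : nat;
  home : 'I_scales -> seed_len.-tuple bool -> 'I_n;
  palette : 'I_scales -> seed_len.-tuple bool -> pred nat;
  clash : 'I_scales -> rel (seed_len.-tuple bool);
  scale_of : 'I_n -> option 'I_scales;
  scale_of_home : forall i x, scale_of (home i x) = Some i;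
  clash_palette : forall i x y c, palette i x c -> palette i y c -> clash i x y
}.

(** * The four rounds of the protocol *)

Section Protocol.

Variables (n : nat) (Sc : scheme n) (B : nat).

Local Notation L := (seed_len Sc).
Local Notation S := (scales Sc).
Local Notation seeds := {ffun 'I_n -> L.-tuple bool}.

(** Colors below this cap fit into [10 * lg n] bits, and by [color_cap_ge] the cap exceeds every
    number of colors that the analysis produces. *)
Definition color_cap : nat := 2 ^ (10 * lg n).
Local Notation M := color_cap.

Lemma color_cap_gt0 : 0 < M. Proof. by rewrite expn_gt0. Qed.

Implicit Types (w : seeds) (N : {set 'I_n}) (u v q : 'I_n) (i : 'I_S).

Definition relevant i w N u : {set 'I_n} :=
  [set v in N | (home i (w v) == home i (w u)) && clash i (w u) (w v)].

Definition counts w N u : {ffun 'I_S -> 'I_n.+1} :=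
  [ffun i => inord #|relevant i w N u|].

Definition load w (cnt : {ffun 'I_n -> {ffun 'I_S -> 'I_n.+1}}) i q : nat :=
  \sum_(a | home i (w a) == q) cnt a i.

(** All counts are broadcast, so every sender evaluates this test itself and sends nothing to an
    overloaded leader. *)
Definition admissible w cnt q : bool :=
  if scale_of Sc q is Some i then load w cnt i q <= B else false.

Definition solves i w (E : {set 'I_n * 'I_n}) q (p : 'I_M * {ffun 'I_n -> 'I_M}) :=
  [forall v, (home i (w v) == q) ==> (p.2 v < p.1) && palette i (w v) (p.2 v)]
  && [forall x in E, p.2 x.1 != p.2 x.2].

Definition solution i w E q :=
  [pick p | solves i w E q p && [forall p', solves i w E q p' ==> (p.1 <= p'.1)]].

Definition leader w (ok : bool) E q :=
  if ok then if scale_of Sc q is Some i then solution i w E q else None else None.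

Definition total (hs : {ffun 'I_n -> option 'I_M}) i : nat :=
  \sum_(q | scale_of Sc q == Some i) oapp val 0 (hs q).

(** The leaders of a scale take consecutive disjoint intervals of colors, in the order of the
    processors. *)
Definition offset (hs : {ffun 'I_n -> option 'I_M}) i q : nat :=
  \sum_(q' | (scale_of Sc q' == Some i) && (q' < q)) oapp val 0 (hs q').

Definition valid (hs : {ffun 'I_n -> option 'I_M}) i : bool :=
  [forall q, (scale_of Sc q == Some i) ==> (hs q != None)].

(** The answers [hs] reach every processor in the last round, so all processors pick the same
    scale. *)
Definition best_scale hs : option 'I_S :=
  [pick i | valid hs i && [forall i', valid hs i' ==> (total hs i <= total hs i')]].

Definition seeds0 : seeds := [ffun=> [tuple of nseq L false]].
Definition col0 : {ffun 'I_n -> 'I_M} := [ffun=> Ordinal color_cap_gt0].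

Definition len1 := n * L + n.
Definition len_counts := S * (lg n).+1.
Definition len2 := n * L + 1.
Definition len3 := n * L + n * (10 * lg n).
Definition len_h := (10 * lg n).+1.

(* An edge goes only to the first end point in its listed orientation, so a
   processor receives at most n of them. *)
Definition step0 (x : local_view n) (c : L.-tuple bool) :=
  ([::] : seq bool,
   fun u => tval c ++ vertices_code
     [seq e.2 | e <- pairs (decode_vertices n (kept x)) & e.1 == u]).

Definition seeds_of (x : local_view n) : seeds :=
  [ffun a => insubd [tuple of nseq L false] (take L (inbox x a))].

Definition nbrs_of (x : local_view n) : {set 'I_n} :=
  [set v | [exists a, v \in decode_vertices n (drop L (inbox x a))]].

Definition step1 (u : 'I_n) (x : local_view n) :=
  (encode len1 (seeds_of x, nbrs_of x),
   fun _ : 'I_n => encode len_counts (counts (seeds_of x) (nbrs_of x) u)).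

Definition step2 (u : 'I_n) (x : local_view n) :=
  let wN := decode len1 (seeds0, set0) (kept x) in
  let cnt := [ffun a => decode len_counts [ffun=> ord0] (inbox x a)] in
  (encode len2 (wN.1, admissible wN.1 cnt u),
   fun q => if admissible wN.1 cnt q then
     if scale_of Sc q is Some i then
       if home i (wN.1 u) == q then vertices_code (enum (relevant i wN.1 wN.2 u))
       else [::]
     else [::]
   else [::]).

Definition step3 (q : 'I_n) (x : local_view n) :=
  let wb := decode len2 (seeds0, false) (kept x) in
  let r := leader wb.1 wb.2
             [set p : 'I_n * 'I_n | p.2 \in decode_vertices n (inbox x p.1)] q in
  (encode len3 (wb.1, oapp snd col0 r),
   fun _ : 'I_n => encode len_h (omap fst r)).

Definition write_colors (q : 'I_n) (x : local_view n) (v : 'I_n) : option nat :=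
  let wc := decode len3 (seeds0, col0) (kept x) in
  let hs := [ffun a => decode len_h None (inbox x a)] in
  if best_scale hs is Some i then
    if home i (wc.1 v) == q then Some (offset hs i q + wc.2 v) else None
  else None.

Definition protocol : mpc_algorithm n n 4 :=
  @MPCAlgorithm n n 4 L
    (fun r q x c =>
       if val r == 0 then step0 x c
       else if val r == 1 then step1 q x
       else if val r == 2 then step2 q x
       else step3 q x)
    write_colors.

(** The interface between protocol and analysis. The witnesses [h] and [chi] are never communicated:
    leaders search exhaustively and do at least as well. *)
Definition good_seeds (e : rel 'I_n) w (K : nat) : Prop :=
  exists (i : 'I_S) (h chi : 'I_n -> nat),
  [/\ forall q, #|[set p : 'I_n * 'I_n | [&& e p.1 p.2, home i (w p.1) == q,
                     home i (w p.2) == q & clash i (w p.1) (w p.2)]]| <= B,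
      forall v, [/\ chi v < h (home i (w v)), chi v < M & palette i (w v) (chi v)],
      forall u v, e u v -> home i (w u) = home i (w v) -> chi u <> chi v,
      forall q, h q < M &
      \sum_(q | scale_of Sc q == Some i) h q <= K].

(** * A run on fixed coins: memory contents and correctness *)

Section Run.

Hypothesis n_gt1 : 1 < n.
Variables (e : rel 'I_n) (inp : 'I_n -> seq ('I_n * 'I_n)).
Hypothesis inpP : edge_distribution e inp.
Variable w : coins protocol.

Let lg0 : 0 < lg n. Proof. exact: lg_gt0. Qed.

Local Notation conf t := (config_at inp w t).

(** From here to [answers], the computed values are expressed directly through coins and input; the
    lemmas up to [decode_inbox4] match them with the configurations. *)
Definition drawn : seeds := [ffun a => w (ord0, a)].
Definition listed u : {set 'I_n} := [set v | [exists a, (u, v) \in inp a]].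
Definition tally : {ffun 'I_n -> {ffun 'I_S -> 'I_n.+1}} :=
  [ffun a => counts drawn (listed a) a].
Definition known q : {set 'I_n * 'I_n} :=
  [set p : 'I_n * 'I_n | admissible drawn tally q &&
    (if scale_of Sc q is Some i then
      (home i (drawn p.1) == q) && (p.2 \in relevant i drawn (listed p.1) p.1)
     else false)].
Definition answer q := leader drawn (admissible drawn tally q) (known q) q.
Definition answers : {ffun 'I_n -> option 'I_M} := [ffun q => omap fst (answer q)].

Lemma answersE q : answers q = omap fst (answer q). Proof. by rewrite ffunE. Qed.

Lemma config0 q : conf 0 q = LocalView (edges_code (inp q)) (fun=> [::]).
Proof. by rewrite /config_at take0. Qed.

Lemma kept1 q : kept (conf 1 q) = [::].
Proof. by rewrite (config_atS inp w (t := 0) isT). Qed.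

Lemma inbox1 q a : inbox (conf 1 q) a =
  tval (drawn a) ++ vertices_code [seq x.2 | x <- inp a & x.1 == q].
Proof.
rewrite (config_atS inp w (t := 0) isT) /= /local_result /= config0 /= edges_codeK //.
by rewrite ffunE; congr (tval (w (_, _)) ++ _); apply: val_inj.
Qed.

Lemma seeds1 q : seeds_of (conf 1 q) = drawn.
Proof.
apply/ffunP => a; rewrite !ffunE inbox1 take_size_cat ?size_tuple //.
by rewrite valKd ffunE.
Qed.

Lemma nbrs1 q : nbrs_of (conf 1 q) = listed q.
Proof.
apply/setP => v; rewrite !inE; apply: eq_existsb => a.
rewrite inbox1 drop_size_cat ?size_tuple // vertices_codeK //.
apply/mapP/idP => [[[x y]]|h].
  by rewrite mem_filter /= => /andP [/eqP -> ?] ->.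
by exists (q, v); rewrite // mem_filter eqxx.
Qed.

Lemma card_seeds : #|{: seeds}| = 2 ^ (n * L).
Proof. by rewrite card_ffun card_tuple card_bool card_ord mulnC expnM. Qed.

Lemma kept2 q : kept (conf 2 q) = encode len1 (drawn, listed q).
Proof.
rewrite (config_atS inp w (t := 1) isT) /= /local_result /=.
by rewrite seeds1 nbrs1.
Qed.

Lemma inbox2 q a : inbox (conf 2 q) a = encode len_counts (tally a).
Proof.
rewrite (config_atS inp w (t := 1) isT) /= /local_result /=.
by rewrite seeds1 nbrs1 ffunE.
Qed.

Lemma decode_kept2 q : decode len1 (seeds0, set0) (kept (conf 2 q)) = (drawn, listed q).
Proof.
have card_sets : #|{: {set 'I_n}}| = 2 ^ n.
  have := card_powerset [set: 'I_n]; rewrite cardsT card_ord => <-.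
  by apply: eq_card => A; rewrite !inE subsetT.
by rewrite kept2 encodeK // card_prod card_seeds card_sets /len1 expnD.
Qed.

Lemma decode_inbox2 q :
  [ffun a => decode len_counts [ffun=> ord0] (inbox (conf 2 q) a)] = tally.
Proof.
apply/ffunP => a; rewrite ffunE inbox2 encodeK // card_ffun !card_ord.
rewrite /len_counts mulnC expnM; apply: leq_expn2r_weak.
by rewrite expnS; have := leq_exp_lg n; have := expn_gt0 2 (lg n); lia.
Qed.


Lemma kept3 q : kept (conf 3 q) = encode len2 (drawn, admissible drawn tally q).
Proof.
rewrite (config_atS inp w (t := 2) isT) /= /local_result /= /step2.
by rewrite decode_kept2 decode_inbox2.
Qed.

Lemma inbox3 q a : inbox (conf 3 q) a =
  if admissible drawn tally q then
    if scale_of Sc q is Some i then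
      if home i (drawn a) == q then vertices_code (enum (relevant i drawn (listed a) a))
      else [::]
    else [::]
  else [::].
Proof.
rewrite (config_atS inp w (t := 2) isT) /= /local_result /= /step2.
by rewrite decode_kept2 decode_inbox2.
Qed.

Lemma decode_kept3 q : decode len2 (seeds0, false) (kept (conf 3 q)) =
  (drawn, admissible drawn tally q).
Proof.
rewrite kept3 encodeK // card_prod card_seeds card_bool.
by rewrite /len2 expnD.
Qed.

Lemma decode_inbox3 q :
  [set p : 'I_n * 'I_n | p.2 \in decode_vertices n (inbox (conf 3 q) p.1)] = known q.
Proof.
apply/setP => -[a v]; rewrite !inE /= inbox3.
have nilE : decode_vertices n [::] = [::] by rewrite -(vertices_codeK lg0 [::]).
case: (admissible _ _ _) => /=; last by rewrite nilE.
case: (scale_of Sc q) => [i|]; last by rewrite nilE.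
case: eqP => [_|_]; last by rewrite nilE.
by rewrite vertices_codeK // mem_enum.
Qed.

Lemma kept4 q : kept (conf 4 q) = encode len3 (drawn, oapp snd col0 (answer q)).
Proof.
rewrite (config_atS inp w (t := 3) isT) /= /local_result /= /step3.
by rewrite decode_kept3 decode_inbox3.
Qed.

Lemma inbox4 q a : inbox (conf 4 q) a = encode len_h (answers a).
Proof.
rewrite (config_atS inp w (t := 3) isT) /= /local_result /= /step3.
by rewrite decode_kept3 decode_inbox3 ffunE.
Qed.

Lemma decode_kept4 q : decode len3 (seeds0, col0) (kept (conf 4 q)) =
  (drawn, oapp snd col0 (answer q)).
Proof.
rewrite kept4 encodeK // card_prod card_seeds card_ffun !card_ord.
by rewrite /len3 expnD -expnM [_ * n]mulnC.
Qed.

Lemma decode_inbox4 q :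
  [ffun a => decode len_h None (inbox (conf 4 q) a)] = answers.
Proof.
apply/ffunP => a; rewrite ffunE inbox4 encodeK // card_option card_ord.
by rewrite /len_h expnS -/M; have := color_cap_gt0; lia.
Qed.

Lemma resultE q v : mpc_result inp w q v =
  if best_scale answers is Some i then
    if home i (drawn v) == q
    then Some (offset answers i q + oapp snd col0 (answer q) v) else None
  else None.
Proof.
rewrite /mpc_result /= /write_colors decode_kept4 decode_inbox4.
by case: (best_scale _).
Qed.

Lemma listedP u v : e u v -> (v \in listed u) || (u \in listed v).
Proof.
move=> euv; have := inpP u v; rewrite euv => h.
apply: contraT; rewrite negb_or !inE => /andP [/existsPn h1 /existsPn h2].
move: h; rewrite big1 // => q _.
by rewrite (count_memPn (h1 q)) (count_memPn (h2 q)).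
Qed.

Lemma listed_edge u v : v \in listed u -> e u v.
Proof.
rewrite inE => /existsP [q uvq]; have := inpP u v; rewrite (bigD1 q) //=.
case: (e u v) => //= /eqP; rewrite !addn_eq0 => /andP [/andP [/eqP c0 _] _].
by move: uvq; rewrite -has_pred1 has_count c0.
Qed.

Lemma tallyE a i : tally a i = #|relevant i drawn (listed a) a| :> nat.
Proof.
by rewrite !ffunE inordK // ltnS -[X in _ <= X](card_ord n) max_card.
Qed.

Lemma loadE i q : load drawn tally i q =
  #|[set p : 'I_n * 'I_n | (home i (drawn p.1) == q) &&
      (p.2 \in relevant i drawn (listed p.1) p.1)]|.
Proof.
rewrite /load -sum1_card (eq_bigl (fun p : 'I_n * 'I_n => (home i (drawn p.1) == q) &&
      (p.2 \in relevant i drawn (listed p.1) p.1))); last by move=> p; rewrite inE.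
rewrite -(pair_big_dep (fun a => home i (drawn a) == q)
  (fun a v => v \in relevant i drawn (listed a) a) (fun _ _ => 1)) /=.
by apply: eq_bigr => a _; rewrite tallyE sum1_card.
Qed.

Lemma solutionP i ws E q p' : solves i ws E q p' ->
  exists p, [/\ solution i ws E q = Some p, solves i ws E q p & p.1 <= p'.1].
Proof.
move=> sp'; rewrite /solution.
case: (arg_minnP (fun p : 'I_M * {ffun 'I_n -> 'I_M} => val p.1) sp') => p sp pmin.
case: pickP => [r /andP [sr /forallP rmin]|/(_ p)].
  by exists r; split=> //; have := rmin p'; rewrite sp'.
by rewrite sp => /negP []; apply/forallP => r; apply/implyP; apply: pmin.
Qed.

(** A leader knows only clashing edges of its own block, so its load is within [B] and [chi] solves
    its instance; the minimal solution then needs at most [h q] colors. *)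
Lemma good_seeds_answer K : good_seeds e drawn K -> exists i (h : 'I_n -> nat),
  \sum_(q | scale_of Sc q == Some i) h q <= K /\
  forall q, scale_of Sc q = Some i -> exists2 p, answer q = Some p & p.1 <= h q.
Proof.
case=> i [h [chi [hload hchi hproper hcap hK]]]; exists i, h; split=> // q qi.
rewrite /answer /leader /admissible qi.
have -> : load drawn tally i q <= B.
  apply: leq_trans (hload q); rewrite loadE; apply: subset_leq_card.
  apply/subsetP => -[a v]; rewrite !inE /= => /andP [/eqP aq /andP [av /andP [/eqP va cl]]].
  by rewrite listed_edge ?inE //= aq va aq eqxx.
have chiM v : chi v < M by case: (hchi v).
have sol : solves i drawn (known q) q
    (Ordinal (hcap q), [ffun v => Ordinal (chiM v)]).
  apply/andP; split.
    apply/forallP => v /=; apply/implyP => /eqP vq; rewrite ffunE /=.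
    by case: (hchi v); rewrite vq => -> _ ->.
  apply/forallP => -[a v] /=; apply/implyP.
  rewrite inE qi /= => /andP [_ /andP [/eqP aq]]; rewrite inE => /andP [av /andP [/eqP va _]].
  rewrite !ffunE; apply/eqP => /(congr1 val) /= eqc.
  exact: (hproper a v (listed_edge av) (esym va) eqc).
by have [p [-> _ ph]] := solutionP sol; exists p.
Qed.

Lemma offset_ltn i q q' : scale_of Sc q = Some i -> q < q' ->
  offset answers i q + oapp val 0 (answers q) <= offset answers i q'.
Proof.
move=> qi lt; rewrite /offset [X in _ <= X](bigD1 q) /=; last by rewrite qi eqxx.
rewrite addnC leq_add2l [X in _ <= X](bigID (fun a : 'I_n => a < q)) /=.
rewrite [X in _ <= X + _](eq_bigl (fun a : 'I_n => (scale_of Sc a == Some i) && (a < q))).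
  exact: leq_addr.
move=> a; rewrite -val_eqE /=.
case: (scale_of Sc a == Some i) => //=; apply/idP/idP; lia.
Qed.

Lemma offset_total i q : scale_of Sc q = Some i ->
  offset answers i q + oapp val 0 (answers q) <= total answers i.
Proof.
move=> qi; rewrite /offset /total [X in _ <= X](bigD1 q) /=; last by rewrite qi.
rewrite addnC leq_add2l [X in _ <= X](bigID (fun a : 'I_n => a < q)) /=.
rewrite [X in _ <= X + _](eq_bigl (fun a : 'I_n => (scale_of Sc a == Some i) && (a < q))).
  exact: leq_addr.
move=> a; rewrite -val_eqE /=.
case: (scale_of Sc a == Some i) => //=; apply/idP/idP; lia.
Qed.

Lemma protocol_correct K : good_seeds e drawn K -> outputs_proper_coloring inp e K w.
Proof.
move=> /good_seeds_answer [i0 [h [hK hi0]]].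
have valid0 : valid answers i0.
  by apply/forallP => q; apply/implyP => /eqP /hi0 [p ap _]; rewrite ffunE ap.
have tot0 : total answers i0 <= K.
  apply: leq_trans hK; apply: leq_sum => q /eqP /hi0 [p ap ph].
  by rewrite ffunE ap.
(* The winning scale may differ from [i0], but it uses no more colors. *)
have [i best [vi toti]] : exists2 i, best_scale answers = Some i &
    valid answers i /\ total answers i <= K.
  rewrite /best_scale; case: pickP => [i /andP [vi /forallP imin]|].
    exists i => //; split=> //; apply: leq_trans tot0.
    by have := imin i0; rewrite valid0.
  case: (arg_minnP (total answers) valid0) => i vi imin /(_ i).
  by rewrite vi => /negP []; apply/forallP => i'; apply/implyP; apply: imin.
have ansP v : exists p, [/\ answer (home i (drawn v)) = Some p,
    admissible drawn tally (home i (drawn v)) &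
    solves i drawn (known (home i (drawn v))) (home i (drawn v)) p].
  have := forallP vi (home i (drawn v)); rewrite scale_of_home eqxx /= ffunE.
  rewrite /answer /leader scale_of_home; case: (admissible _ _ _) => //.
  rewrite /solution; case: pickP => // p /andP [sp _] _; exists p; split=> //.
pose col v := offset answers i (home i (drawn v)) +
  oapp snd col0 (answer (home i (drawn v))) v.
have col_lt v : col v < offset answers i (home i (drawn v)) +
    oapp val 0 (answers (home i (drawn v))).
  have [p [ap _ /andP [/forallP /(_ v)]]] := ansP v.
  by rewrite eqxx /= => /andP [lt _] _; rewrite /col answersE ap /= ltn_add2l.
have colK v : col v < K.
  apply: leq_trans (col_lt v) (leq_trans (offset_total _) toti).
  exact: scale_of_home.
have proper u v : v \in listed u -> col u != col v.
  move=> uv; case: (ltngtP (home i (drawn u)) (home i (drawn v))) => cmp.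
  - have := leq_trans (col_lt u) (offset_ltn (scale_of_home i (drawn u)) cmp).
    by rewrite /col; lia.
  - have := leq_trans (col_lt v) (offset_ltn (scale_of_home i (drawn v)) cmp).
    by rewrite /col; lia.
  have {}cmp := val_inj cmp.
  have [p [ap adm /andP [/forallP pal /forallP prop]]] := ansP u.
  rewrite /col -cmp ap /= eqn_add2l.
  apply/eqP => eqc.
  have := pal u; rewrite eqxx /= => /andP [_ pu].
  have := pal v; rewrite cmp eqxx /= => /andP [_ pv].
  (* A common color lies in both palettes and forces a clash; hence the edge was sent to the leader,
     whose solution separates its ends. *)
  have cl : clash i (drawn u) (drawn v).
    by apply: (clash_palette pu); rewrite eqc.
  have := prop (u, v); rewrite inE adm scale_of_home eqxx /= inE uv cmp eqxx cl /=.
  by rewrite -val_eqE /= eqc eqxx.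
pose chi := [ffun v => Ordinal (colK v)].
have chiE v : val (chi v) = col v by rewrite ffunE.
apply/existsP; exists chi; apply/andP; split.
  apply/forallP => v; apply/andP; split.
    apply/existsP; exists (home i (drawn v)).
    by rewrite resultE best eqxx chiE.
  apply/forallP => q; rewrite resultE best chiE.
  by case: (home i (drawn v) =P q) => [<-|_] /=; rewrite /col ?eqxx ?orbT.
apply/forallP => u; apply/forallP => v; apply/implyP => /listedP /orP [] uv.
  by rewrite -val_eqE !chiE proper.
by rewrite eq_sym -val_eqE !chiE proper.
Qed.

(** Lets the sizes computed for inboxes serve again for outgoing messages. *)
Lemma sentE (r : 'I_4) q u :
  (local_result w r (conf r) q).2 u = inbox (conf r.+1 u) q.
Proof.
rewrite (config_atS inp w (ltn_ord r)) /=.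
by have -> : Ordinal (ltn_ord r) = r by apply: val_inj.
Qed.

Lemma sum_heads_list (s : seq ('I_n * 'I_n)) :
  \sum_u size [seq x <- s | x.1 == u] = size s.
Proof.
elim: s => [|x s IH]; first by rewrite big1.
rewrite /= -add1n -IH.
rewrite [LHS](eq_bigr (fun u => (x.1 == u) + size [seq y <- s | y.1 == u])).
  rewrite big_split /= (bigD1 x.1) //= eqxx big1 // => u /negbTE ux.
  by rewrite eq_sym ux.
by move=> u _ /=; case: ifP.
Qed.

(** Over all processors together, a pair [(u, v)] is listed at most once, and there are [n] choices
    of [v]. *)
Lemma sum_heads u : \sum_a size [seq x <- inp a | x.1 == u] <= n.
Proof.
rewrite (eq_bigr (fun a => \sum_v count_mem (u, v) (inp a))); last first.
  move=> a _; rewrite size_filter; elim: (inp a) => [|[x y] s IH].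
    by rewrite big1.
  rewrite [RHS](eq_bigr (fun v => ((x, y) == (u, v)) + count_mem (u, v) s)) //.
  rewrite big_split /= IH; congr (_ + _).
  rewrite (bigD1 y) //= big1 ?addn0 => [|v /negbTE vy].
    by rewrite xpair_eqE eqxx andbT.
  by rewrite xpair_eqE [y == v]eq_sym vy andbF.
rewrite exchange_big /=; apply: (@leq_trans (\sum_(v < n) 1)); last first.
  by rewrite sum_nat_const card_ord muln1.
apply: leq_sum => v _; apply: (@leq_trans (e u v)); last by case: (e u v).
by rewrite -inpP; apply: leq_sum => a _; apply: leq_addr.
Qed.

Lemma size_inbox3 q a : size (inbox (conf 3 q) a) =
  (if admissible drawn tally q then
    if scale_of Sc q is Some i then
      if home i (drawn a) == q then tally a i : nat else 0
    else 0
  else 0) * lg n.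
Proof.
rewrite inbox3; case: (admissible _ _ _) => //.
case: (scale_of Sc q) => // i; case: eqP => // _.
by rewrite size_vertices_code -cardE tallyE.
Qed.

(** * Memory and communication bounds *)

Section Memory.

Variables cB C : nat.
Hypothesis L_le : L <= lg n ^ 2.
Hypothesis S_le : S <= (lg n).+1.
Hypothesis B_le : B <= cB * (n * lg n).
Hypothesis C_ge : cB + 40 <= C.
Hypothesis inp_le : forall q, size (edges_code (inp q)) <= memory_bits C n.

Let X := n * lg n ^ 2.

Let nL_le : n * L <= X. Proof. by rewrite leq_mul2l L_le orbT. Qed.
Let nlg_le : n * lg n <= X.
Proof. by rewrite leq_mul2l expnS expn1 leq_pmulr ?orbT. Qed.
Let n_le : n <= X.
Proof. by rewrite leq_pmulr // expn_gt0 lg0. Qed.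
Let nS_le : n * len_counts <= 4 * X.
Proof.
rewrite /X [4 * _]mulnCA leq_mul2l /len_counts; apply/orP; right.
apply: (leq_trans (leq_mul S_le (leqnn _))).
by rewrite expnS expn1; nia.
Qed.
Let nSlg_le : n * S * lg n <= 2 * X.
Proof.
rewrite /X -mulnA [2 * _]mulnCA leq_mul2l; apply/orP; right.
apply: (leq_trans (leq_mul S_le (leqnn _))).
by rewrite expnS expn1; nia.
Qed.
Let nh_le : n * len_h <= 11 * X.
Proof. by rewrite /len_h; lia. Qed.
Let Blg_le : B * lg n <= cB * X.
Proof.
apply: (leq_trans (leq_mul B_le (leqnn _))).
by rewrite /X expnS expn1 !mulnA.
Qed.
Let CX : (cB + 40) * X <= memory_bits C n.
Proof. by rewrite /memory_bits leq_mul2r C_ge orbT. Qed.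

Lemma inbox_le0 q : total_size (inbox (conf 0 q)) = 0.
Proof. by rewrite /total_size big1 // => a _; rewrite config0. Qed.

Lemma inbox_le1 q : total_size (inbox (conf 1 q)) <= 2 * X.
Proof.
rewrite /total_size.
rewrite (eq_bigr (fun a => L + size [seq x <- inp a | x.1 == q] * lg n)); last first.
  by move=> a _; rewrite inbox1 size_cat size_tuple size_vertices_code size_map.
rewrite big_split /= sum_nat_const card_ord -big_distrl /=.
rewrite mul2n -addnn leq_add //; apply: leq_trans nlg_le.
by rewrite leq_mul2r sum_heads orbT.
Qed.

Lemma inbox_le2 q : total_size (inbox (conf 2 q)) <= 4 * X.
Proof.
rewrite /total_size (eq_bigr (fun=> len_counts)) ?sum_nat_const ?card_ord //.
by move=> a _; rewrite inbox2 size_encode.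
Qed.

(** No randomness is involved: a leader that fails the admissibility test receives nothing, and any
    other receives at most [B] names. *)
Lemma inbox_le3 q : total_size (inbox (conf 3 q)) <= cB * X.
Proof.
apply: leq_trans Blg_le; rewrite /total_size.
under eq_bigr => a _ do rewrite size_inbox3.
rewrite -big_distrl /= leq_mul2r; apply/orP; right.
rewrite /admissible; case: (scale_of Sc q) => [i|]; last by rewrite big1.
by case hB: (load _ _ _ _ <= _); [rewrite -big_mkcond|rewrite big1].
Qed.

Lemma inbox_le4 q : total_size (inbox (conf 4 q)) <= 11 * X.
Proof.
rewrite /total_size (eq_bigr (fun=> len_h)) ?sum_nat_const ?card_ord //.
by move=> a _; rewrite inbox4 size_encode.
Qed.

Lemma view_le t q : t <= 4 -> view_size (conf t q) <= memory_bits C n.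
Proof.
rewrite /view_size; case: t => [|[|[|[|[|t]]]]] // _.
- by rewrite inbox_le0 addn0 config0 /=; apply: inp_le.
- rewrite kept1; apply: leq_trans CX; have := inbox_le1 q; rewrite mulnDl /=; lia.
- rewrite kept2 size_encode /len1; apply: leq_trans CX.
  have := inbox_le2 q; rewrite mulnDl; lia.
- rewrite kept3 size_encode /len2; apply: leq_trans CX.
  have := inbox_le3 q; rewrite mulnDl; lia.
rewrite kept4 size_encode /len3; apply: leq_trans CX.
have := inbox_le4 q; rewrite mulnDl; lia.
Qed.

Lemma sent_le (r : 'I_4) q :
  total_size (local_result w r (conf r) q).2 <= memory_bits C n.
Proof.
rewrite /total_size; under eq_bigr => u _ do rewrite sentE.
case: r => -[|[|[|[|//]]]] ? /=.
- rewrite (eq_bigr (fun u => L + size [seq x <- inp q | x.1 == u] * lg n)); last first.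
    by move=> u _; rewrite inbox1 size_cat size_tuple size_vertices_code size_map.
  rewrite big_split /= sum_nat_const card_ord -big_distrl /= sum_heads_list.
  have := inp_le q; rewrite size_edges_code; move: CX; rewrite mulnDl mulnCA; lia.
- rewrite (eq_bigr (fun=> len_counts)) => [|u _]; last by rewrite inbox2 size_encode.
  rewrite sum_nat_const card_ord; apply: leq_trans CX; rewrite mulnDl; lia.
(* At each scale [q] has one home, to which it sends at most [n] names; summed over the scales this
   is at most [n * S] names. *)
- apply: (@leq_trans (\sum_u (\sum_i (home i (drawn q) == u) * n) * lg n)).
    apply: leq_sum => u _; rewrite size_inbox3 leq_mul2r; apply/orP; right.
    case: (admissible _ _ _) => //; case: (scale_of Sc u) => // i.
    rewrite (bigD1 i) //=; case: eqP => // _.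
    rewrite mul1n; apply: leq_trans (leq_addr _ _).
    by rewrite -ltnS.
  rewrite -big_distrl /= exchange_big /=.
  rewrite (eq_bigr (fun=> n)) => [|i _].
    rewrite sum_nat_const card_ord; apply: leq_trans CX; rewrite mulnDl; lia.
  rewrite -big_distrl /= (bigD1 (home i (drawn q))) //= eqxx big1 ?mul1n //.
  by move=> u /negbTE; rewrite eq_sym => ->.
rewrite (eq_bigr (fun=> len_h)) => [|u _]; last by rewrite inbox4 size_encode.
rewrite sum_nat_const card_ord; apply: leq_trans CX; rewrite mulnDl; lia.
Qed.

End Memory.
End Run.
End Protocol.

(** * Degeneracy orders, greedy colorings and seeds *)

Section DegeneracyOrder.

Variables (T : finType) (e : rel T) (k : nat).
Hypothesis deg_k : degenerate e k.

(** A vertex of degree at most [k] in the subgraph induced on [A] is placed last, and the rest is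
    ordered recursively. *)
Lemma degenerate_order_set (A : {set T}) : exists s : seq T,
  [/\ uniq s, s =i A & forall v, v \in A ->
      #|[set u in A | e v u && (index u s < index v s)]| <= k].
Proof.
move: {2}_.+1 (ltnSn #|A|) => N; elim: N A => // N IH A; rewrite ltnS => leAN.
have [->|A0] := eqVneq A set0.
  by exists [::]; split=> // v; rewrite ?inE.
have := forallP deg_k A; rewrite A0 /= => /existsP [v /andP [vA degv]].
have [|s [us sA sk]] := IH (A :\ v).
  by move: leAN; rewrite (cardsD1 v) vA.
have vs : v \notin s by rewrite sA !inE eqxx.
have idx u : u \in s -> index u (rcons s v) = index u s.
  by move=> us'; rewrite -cats1 index_cat us'.
have idxv : index v (rcons s v) = size s.
  by rewrite -cats1 index_cat (negbTE vs) /= eqxx addn0.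
exists (rcons s v); split.
- by rewrite rcons_uniq vs.
- by move=> u; rewrite mem_rcons inE sA !inE; case: eqP => // ->.
move=> x xA; have [->|xv] := eqVneq x v.
  apply: leq_trans degv; apply: subset_leq_card; apply/subsetP => u.
  by rewrite !inE => /and3P [-> ->].
have xs : x \in s by rewrite sA !inE xv.
apply: leq_trans (sk x _); last by rewrite !inE xv.
apply: subset_leq_card; apply/subsetP => u.
rewrite !inE [index x _]idx // => /and3P [uA exu].
have [->|uv] := eqVneq u v; first by rewrite idxv ltnNge index_size.
by rewrite idx ?sA ?inE ?uv // exu uA.
Qed.

Lemma degenerate_order : exists rk : T -> nat,
  injective rk /\ forall v, #|[set u | e v u && (rk u < rk v)]| <= k.
Proof.
have [s [us sT sk]] := degenerate_order_set setT.
exists (index ^~ s); split.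
  move=> u v uv; rewrite -(nth_index u (_ : u \in s)) ?sT ?inE // uv nth_index //.
  by rewrite sT inE.
move=> v; apply: leq_trans (sk v (in_setT v)); apply: subset_leq_card.
by apply/subsetP => u; rewrite !inE.
Qed.

End DegeneracyOrder.

Lemma degeneracyP (T : finType) (e : rel T) : degenerate e (degeneracy e).
Proof. by rewrite /degeneracy; case: ex_minnP. Qed.

Lemma degeneracy_le (T : finType) (e : rel T) : irreflexive e -> degeneracy e <= #|T|.-1.
Proof.
move=> irr; rewrite /degeneracy; case: ex_minnP => m _; apply.
apply/forallP => A; apply/implyP => /set0Pn [v vA].
apply/existsP; exists v; rewrite vA /=.
have -> : #|T|.-1 = #|[set~ v]| by rewrite cardsC1.
apply: subset_leq_card; apply/subsetP => u; rewrite !inE => /andP [_ evu].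
by apply: contraTneq evu => ->; rewrite irr.
Qed.

(** * Greedy recursion along an order *)

Section Greedy.

Variables (V : finType) (A : Type) (rk : V -> nat) (a0 : A).

(** Stage [k] has settled the vertices of rank below [k]; all others still carry [a0]. *)
Fixpoint greedy_upto (F : V -> (V -> A) -> A) (k : nat) (v : V) : A :=
  if k is k'.+1 then
    if rk v == k' then F v (greedy_upto F k') else greedy_upto F k' v
  else a0.

Definition greedy F v := greedy_upto F (rk v).+1 v.

Lemma greedy_uptoE F k v : rk v < k -> greedy_upto F k v = greedy F v.
Proof.
elim: k => // k IH; rewrite ltnS leq_eqVlt => /orP [/eqP kv|kv] /=.
  by rewrite /greedy /= kv !eqxx.
by rewrite (ltn_eqF kv) IH.
Qed.

Lemma greedyE F v :
  (forall c c', (forall u, rk u < rk v -> c u = c' u) -> F v c = F v c') ->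
  greedy F v = F v (greedy F).
Proof.
move=> locF; rewrite {1}/greedy /= eqxx; apply: locF => u uv.
exact: greedy_uptoE.
Qed.

End Greedy.

Lemma free_color (V : finType) (O : {set V}) (c : V -> nat) (d : nat) :
  #|O| < d -> exists x : 'I_d, [forall u in O, c u != x].
Proof.
move=> Od; apply/existsP; apply: contraT; rewrite negb_exists => /forallP used.
move: Od; rewrite ltnNge => /negP []; rewrite -{1}(size_iota 0 d) cardE.
rewrite -(size_map c); apply: uniq_leq_size (iota_uniq _ _) _ => x.
rewrite mem_iota /= add0n => xd.
have := used (Ordinal xd); rewrite negb_forall => /existsP [u].
by rewrite negb_imply negbK /= => /andP [uO /eqP <-]; rewrite map_f // mem_enum.
Qed.

Lemma ordered_coloring (V : finType) (e : rel V) (rk : V -> nat) (d : nat) :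
  injective rk -> symmetric e -> irreflexive e ->
  (forall v, #|[set u | e v u && (rk u < rk v)]| < d) ->
  exists chi : V -> nat, (forall v, chi v < d) /\ forall u v, e u v -> chi u <> chi v.
Proof.
move=> rk_inj sym irr out_lt.
pose F v (c : V -> nat) : nat :=
  oapp val 0 [pick x : 'I_d | [forall u in [set u | e v u && (rk u < rk v)], c u != x]].
have FE v : greedy rk 0 F v = F v (greedy rk 0 F).
  apply: greedyE => c c' cc'; rewrite /F; congr (oapp _ _ _); apply: eq_pick => x.
  apply: eq_forallb => u; rewrite inE.
  by case: (e v u) => //=; case: (ltnP (rk u) (rk v)) => // /cc' ->.
have FP v c : F v c < d /\ forall u, e v u -> rk u < rk v -> c u <> F v c.
  rewrite /F; case: pickP => [x /forallP xP|none] /=.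
    split=> // u evu uv; apply/eqP.
    by have := xP u; rewrite inE evu uv.
  by have [x xP] := free_color c (out_lt v); have := none x; rewrite xP.
exists (greedy rk 0 F); split=> [v|u v]; first by rewrite FE; case: (FP v (greedy rk 0 F)).
wlog uv : u v / rk u < rk v => [hw euv|].
  case: (ltngtP (rk u) (rk v)) => [uv|vu|/rk_inj eqv].
  - exact: hw.
  - by move/esym; apply: hw => //; rewrite sym.
  by move: euv; rewrite eqv irr.
rewrite sym => evu; rewrite [X in _ <> X]FE.
by case: (FP v (greedy rk 0 F)) => _; apply.
Qed.

(** Each edge is charged to its later end; the factor 2 accounts for the two orientations. *)
Lemma card_edges_le (V : finType) (e Q : rel V) (rk : V -> nat) :
  injective rk -> symmetric e -> irreflexive e -> symmetric Q ->
  #|[set p : V * V | e p.1 p.2 && Q p.1 p.2]| <=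
  2 * \sum_v #|[set u in [set u | e v u && (rk u < rk v)] | Q v u]|.
Proof.
move=> rk_inj sym irr symQ.
pose D := [set p : V * V | [&& e p.1 p.2, rk p.2 < rk p.1 & Q p.1 p.2]].
have cardD : #|D| = \sum_v #|[set u in [set u | e v u && (rk u < rk v)] | Q v u]|.
  rewrite -sum1_card.
  rewrite (eq_bigl (fun p : V * V => [&& e p.1 p.2, rk p.2 < rk p.1 & Q p.1 p.2])); last first.
    by move=> p; rewrite inE.
  rewrite -(pair_big_dep xpredT (fun v u => [&& e v u, rk u < rk v & Q v u])
    (fun _ _ => 1)) /=.
  apply: eq_bigr => v _; rewrite -sum1_card; apply: eq_bigl => u.
  by rewrite !inE andbA.
rewrite -cardD mul2n -addnn.
pose sw (p : V * V) := (p.2, p.1).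
have sw_inj : injective sw by move=> [a b] [c d] [-> ->].
apply: (@leq_trans #|D :|: sw @: D|); last first.
  by rewrite cardsU card_imset // leq_subr.
apply: subset_leq_card; apply/subsetP => -[u v]; rewrite !inE /= => /andP [euv quv].
case: (ltngtP (rk u) (rk v)) => [uv|vu|/rk_inj eqv].
- apply/orP; right; apply/imsetP; exists (v, u) => //.
  by rewrite inE /= sym euv uv symQ.
- by rewrite euv quv.
by move: euv; rewrite eqv irr.
Qed.

(** The first two terms of the binomial expansion of [q.+1 ^ q] already suffice. *)
Lemma double_pow_le q : 0 < q -> 2 * q ^ q <= q.+1 ^ q.
Proof.
case: q => // q _.
have : q.+1 ^ q.+1 + q.+1 * q.+1 ^ q <= q.+2 ^ q.+1.
  have main m : q.+1 ^ m + m * q.+1 ^ m.-1 <= q.+2 ^ m.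
    elim: m => // m IH; rewrite !expnS /=.
    have := leq_mul (leqnn q.+2) IH.
    case: m {IH} => [|m] /=; first by rewrite !expn0; lia.
    by rewrite !expnS; nia.
  by have := main q.+1.
by rewrite -expnS mul2n addnn.
Qed.

(** * Seeds as tuples of uniform independent digits *)

Section Digits.

Variables (s m : nat).

Local Notation T := ((s * m).-tuple bool).
Local Notation X := {ffun 'I_s -> 'I_(2 ^ m)}.

Lemma card_seed_space : #|{: T}| = #|{: X}|.
Proof. by rewrite card_tuple card_ffun card_bool !card_ord mulnC expnM. Qed.

(** Any bijection would do: only the uniform distribution of the digits matters, not their relation
    to the bits. *)
Definition unpack (t : T) : X := enum_val (cast_ord card_seed_space (enum_rank t)).

Definition digit (t : T) (k : 'I_s) : nat := unpack t k.

Lemma unpack_inj : injective unpack.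
Proof. by move=> t u /enum_val_inj /cast_ord_inj /enum_rank_inj. Qed.

Lemma card_unpack (P : pred X) : #|[set t | P (unpack t)]| = #|[set x | P x]|.
Proof.
have bij : bijective unpack by apply: inj_card_bij unpack_inj _; rewrite card_seed_space.
rewrite -(on_card_preimset (f := unpack)); first by apply: eq_card => t; rewrite !inE.
by case: bij => g gK Kg; exists g => x _; [apply: gK|apply: Kg].
Qed.

(** Since [2 ^ a] divides [2 ^ m], the residue of a uniform digit is uniform; quotient and remainder
    give the injection. *)
Lemma card_mod_le (a : nat) (P : pred nat) : a <= m ->
  #|[set y : 'I_(2 ^ m) | P (y %% 2 ^ a)]| * 2 ^ a <=
  #|[set z : 'I_(2 ^ a) | P z]| * 2 ^ m.
Proof.
move=> am.
have eqm : 2 ^ m = 2 ^ (m - a) * 2 ^ a by rewrite -expnD subnK.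
rewrite [X in _ <= _ * X]eqm mulnA leq_mul2r; apply/orP; right.
have p0 : 0 < 2 ^ a by rewrite expn_gt0.
have qlt (y : 'I_(2 ^ m)) : y %/ 2 ^ a < 2 ^ (m - a).
  by rewrite ltn_divLR // -eqm.
pose f (y : 'I_(2 ^ m)) : 'I_(2 ^ a) * 'I_(2 ^ (m - a)) :=
  (Ordinal (ltn_pmod y p0), Ordinal (qlt y)).
have f_inj : injective f.
  move=> y z [h1 h2]; apply: val_inj => /=.
  by rewrite (divn_eq y (2 ^ a)) (divn_eq z (2 ^ a)) h1 h2.
rewrite -(card_imset _ f_inj) -[X in _ <= _ * X]card_ord -[X in _ <= _ * X]cardsT -cardsX.
apply: subset_leq_card; apply/subsetP => p /imsetP [y].
by rewrite !inE => Py ->; rewrite Py.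
Qed.

Lemma card_digit_all (a : nat) (P : pred nat) : a <= m ->
  #|[set t : T | [forall k, P (digit t k %% 2 ^ a)]]| * (2 ^ a) ^ s <=
  #|{: T}| * #|[set z : 'I_(2 ^ a) | P z]| ^ s.
Proof.
move=> am.
rewrite (card_unpack (fun x => [forall k, P (x k %% 2 ^ a)])).
have -> : #|[set x : X | [forall k, P (x k %% 2 ^ a)]]| =
    #|[set y : 'I_(2 ^ m) | P (y %% 2 ^ a)]| ^ s.
  set Q := [set y : 'I_(2 ^ m) | P (y %% 2 ^ a)].
  have <- : #|(ffun_on (mem Q) : {pred X})| = #|Q| ^ s by rewrite card_ffun_on card_ord.
  apply: eq_card => x.
  by rewrite inE; apply/forallP/ffun_onP => h k; have := h k; rewrite inE.
rewrite -expnMn; apply: (leq_trans (leq_expn2r_weak _ (card_mod_le P am))).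
by rewrite expnMn mulnC card_seed_space card_ffun !card_ord.
Qed.

Lemma card_digit_one (a z : nat) (k : 'I_s) : a <= m ->
  #|[set t : T | digit t k %% 2 ^ a == z]| * 2 ^ a <= #|{: T}|.
Proof.
move=> am.
rewrite (card_unpack (fun x => x k %% 2 ^ a == z)) card_seed_space.
pose Q := [set y : 'I_(2 ^ m) | y %% 2 ^ a == z].
(* Redrawing the single coordinate [k] reduces the count over tuples to a count over one digit. *)
have coord : 2 ^ m * #|[set x : X | x k %% 2 ^ a == z]| = #|{: X}| * #|Q|.
  have := sum_resample (fun x : X => ((x k %% 2 ^ a == z)%N%:R : rat)%R) k.
  rewrite card_ord.
  rewrite (eq_bigr (fun=> (#|Q|%:R : rat)%R)) => [|x _]; last first.
    rewrite -sum1_card natr_sum [RHS]big_mkcond /=; apply: eq_bigr => y _.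
    by rewrite ffunE eqxx inE; case: eqP.
  rewrite sumr_const -[X in (_ = _ * X)%R -> _]natr_sum => /eqP.
  rewrite -mulrnA -natrM eqr_nat => /eqP sumE.
  rewrite [RHS]mulnC sumE; congr (_ * _)%N; rewrite -sum1_card [LHS]big_mkcond /=.
  by apply: eq_bigr => x _; rewrite inE; case: eqP.
have Qle : #|Q| * 2 ^ a <= 2 ^ m.
  apply: leq_trans (card_mod_le (fun y => y == z) am) _.
  rewrite -[X in _ <= X]mul1n leq_mul2r; apply/orP; right.
  apply/card_le1_eqP => x y; rewrite !inE => /eqP xz /eqP yz.
  by apply: val_inj; rewrite /= xz yz.
rewrite -(leq_pmul2l (expn_gt0 2 m : 0 < 2 ^ m)) mulnA coord -mulnA.
by rewrite [X in _ <= X]mulnC leq_mul2l Qle orbT.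
Qed.

End Digits.

(** * Blocks and lists *)

Lemma union_bound (I W : finType) (P : I -> pred W) (x y : nat) :
  (forall i, #|[set w | P i w]| * x <= y) ->
  #|[set w | [exists i, P i w]]| * x <= #|I| * y.
Proof.
move=> hP; have -> : #|I| * y = \sum_(i : I) y by rewrite sum_nat_const.
apply: (@leq_trans (\sum_i #|[set w | P i w]| * x)); last by apply: leq_sum.
rewrite -big_distrl leq_mul2r; apply/orP; right => /=.
rewrite -sum1_card big_mkcond /=.
rewrite (eq_bigr (fun i => \sum_w (P i w : nat))) => [|i _]; last first.
  rewrite -sum1_card big_mkcond /=; apply: eq_bigr => w _.
  by rewrite inE; case: (P i w).
rewrite exchange_big /=; apply: leq_sum => w _; rewrite inE.
by case: existsP => // -[i Pi]; rewrite (bigD1 i) //= Pi.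
Qed.

Lemma ffact_ge m j : (m - j) ^ j <= m ^_ j.
Proof.
elim: j => [|j IH]; first by rewrite ffactn0.
rewrite ffactnSr expnSr leq_mul //; last by lia.
by apply: leq_trans IH; apply: leq_expn2r_weak; lia.
Qed.

(** Raising l to l+1 doubles the [l]-th power, and this is used [q] times. *)
Lemma pow_gap l q j : 0 < l -> l * q <= j -> 2 ^ q * l ^ j <= l.+1 ^ j.
Proof.
move=> l0 lqj; rewrite -(subnKC lqj) !expnD mulnA leq_mul //; last first.
  exact: leq_expn2r_weak.
by rewrite !expnM -expnMn; apply: leq_expn2r_weak; apply: double_pow_le.
Qed.

(** Turns the factorial moment bound into a failure probability of at most 2^(-q): the moment ratio
    is at most (mu / (mu + j))^j, and [mu <= l * j] makes this at most (l / (l + 1))^j. *)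
Lemma tail_arith (x y A D mu l j m q : nat) :
  0 < D -> 0 < mu -> 0 < l -> A <= D * mu -> mu + 2 * j <= m -> mu <= l * j ->
  l * q <= j -> x * (m ^_ j * D ^ j) <= y * A ^ j -> x * 2 ^ q <= y.
Proof.
move=> D0 mu0 l0 hA hm hmu hq hx.
have Dj : 0 < D ^ j by rewrite expn_gt0 D0.
have muj : 0 < mu ^ j by rewrite expn_gt0 mu0.
have lj : 0 < l ^ j by rewrite expn_gt0 l0.
have h1 : x * (mu + j) ^ j <= y * mu ^ j.
  rewrite -(leq_pmul2r Dj) -!mulnA -[mu ^ j * D ^ j]expnMn [mu * D]mulnC.
  apply: leq_trans (leq_trans hx _); last first.
    by rewrite leq_mul2l leq_expn2r_weak ?orbT.
  rewrite leq_mul2l leq_mul2r; apply/orP; right; apply/orP; right.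
  by apply: leq_trans (ffact_ge m j); apply: leq_expn2r_weak; lia.
have h2 : x * l.+1 ^ j <= y * l ^ j.
  rewrite -(leq_pmul2r muj) -mulnA -expnMn.
  apply: (@leq_trans (x * (mu + j) ^ j * l ^ j)); last first.
    by rewrite [y * _ * _]mulnAC leq_mul2r h1 orbT.
  rewrite -mulnA -expnMn leq_mul2l leq_expn2r_weak ?orbT //; nia.
rewrite -(leq_pmul2r lj) -mulnA; apply: leq_trans h2.
by rewrite leq_mul2l pow_gap ?orbT.
Qed.

(* The colors are a reserve of [2 ^ b] groups of j colors, followed by the main
   palette; a seed gives access to one group and to s main colors. *)
Section ListPalettes.

Variables (s m : nat) (k0 : 'I_s) (b j a : nat).

Local Notation T := ((s * m).-tuple bool).

Definition list_palette (t : T) (c : nat) : bool :=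
  (c < 2 ^ b * j) && (c %/ j == digit t k0 %% 2 ^ b)
  || [exists k, c == 2 ^ b * j + digit t k %% 2 ^ a].

(** This overestimates the intersection of palettes: reserve groups are compared as a whole, and
    main colors are compared as residues. *)
Definition list_clash (t t' : T) : bool :=
  (digit t k0 %% 2 ^ b == digit t' k0 %% 2 ^ b)
  || [exists p : 'I_s * 'I_s, digit t p.1 %% 2 ^ a == digit t' p.2 %% 2 ^ a].

Lemma list_clash_palette t t' c :
  list_palette t c -> list_palette t' c -> list_clash t t'.
Proof.
rewrite /list_palette /list_clash => /orP [/andP [lt /eqP h]|/existsP [k /eqP h]].
  case/orP => [/andP [_ /eqP h']|/existsP [k' /eqP h']].
    by rewrite -h -h' eqxx.
  by move: lt; rewrite h' ltnNge leq_addr.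
case/orP => [/andP [lt _]|/existsP [k' /eqP h']].
  by move: lt; rewrite h ltnNge leq_addr.
apply/orP; right; apply/existsP; exists (k, k') => /=.
by rewrite -(eqn_add2l (2 ^ b * j)) -h -h'.
Qed.

Lemma list_clash_sym : symmetric list_clash.
Proof.
move=> t t'; rewrite /list_clash eq_sym; congr (_ || _).
by apply/existsP/existsP => -[[k k'] /eqP h]; exists (k', k); rewrite /= h.
Qed.

(** Union bound: the reserve groups agree with probability at most 2^(-b), and each of the [s * s]
    pairs of main colors agrees with probability at most 2^(-a). *)
Lemma card_list_clash t' : b <= a -> a <= m ->
  #|[set t | list_clash t t']| * 2 ^ a <= #|{: T}| * (2 ^ (a - b) + s * s).
Proof.
move=> ba am.
pose A := [set t : T | digit t k0 %% 2 ^ b == digit t' k0 %% 2 ^ b].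
pose D := [set t : T | [exists p : 'I_s * 'I_s, digit t p.1 %% 2 ^ a == digit t' p.2 %% 2 ^ a]].
have -> : [set t | list_clash t t'] = A :|: D by apply/setP => t; rewrite !inE.
apply: (@leq_trans ((#|A| + #|D|) * 2 ^ a)).
  by rewrite leq_mul2r cardsU leq_subr orbT.
rewrite mulnDl mulnDr leq_add //.
  rewrite -{1}(subnK ba) expnD [2 ^ (a - b) * _]mulnC mulnA leq_mul2r.
  by rewrite card_digit_one ?orbT // (leq_trans ba).
rewrite [#|{: T}| * _]mulnC -[X in X * X]card_ord -card_prod.
by apply: union_bound => p; apply: card_digit_one.
Qed.

End ListPalettes.

(** * Random seeds: [lam] and [m] stand for log log n and log n, [i] for the scale of the
    degeneracy *)

Section Analysis.

Variables (n lam s m : nat) (J : finType) (pos : 'I_n -> J).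
Hypothesis pos_inj : injective pos.
Hypothesis n_gt1 : 1 < n.
Hypothesis lam_gt0 : 0 < lam.
Hypothesis lam_big : 400 * lam ^ 4 <= 2 ^ lam.
Hypothesis n_le : n <= 2 ^ m.
Hypothesis m_le : m <= 2 ^ lam.
Variable k0 : 'I_s.

Local Notation T := ((s * m).-tuple bool).
Local Notation space := {ffun J -> T}.

Variables (e : rel 'I_n) (kap : nat) (rk : 'I_n -> nat).
Hypothesis e_sym : symmetric e.
Hypothesis e_irr : irreflexive e.
Hypothesis rk_inj : injective rk.

Definition earlier (v : 'I_n) : {set 'I_n} := [set u | e v u && (rk u < rk v)].

Hypothesis earlier_le : forall v, #|earlier v| <= kap.
Hypothesis kap_le : kap <= n.
Variable i : nat.
Hypothesis kap_gt : 2 ^ i.-1 < kap.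
Hypothesis kap_le2 : kap <= 2 ^ i.

Lemma seeds_gt0 : 0 < #|{: T}|.
Proof. by rewrite card_tuple card_bool expn_gt0. Qed.

Lemma resampleE (w : space) v t u :
  resample w (pos v) t (pos u) = if u == v then t else w (pos u).
Proof. by rewrite ffunE (inj_eq pos_inj). Qed.

Lemma resample_ltn (w : space) u v t : rk u < rk v ->
  resample w (pos v) t (pos u) = w (pos u).
Proof. by rewrite resampleE; case: eqP => // ->; rewrite ltnn. Qed.

(** * Large degeneracy: random blocks *)

Section Blocks.

Hypothesis i_gt : 4 * lam < i.
Hypothesis i_le : i <= m.

(** Chosen so that the mean degree [kap / nblocks] lies between 2^(2 lam - 1) and 2^(2 lam). *)
Definition nblocks := 2 ^ (i - 2 * lam).
Definition block (t : T) : nat := digit t k0 %% nblocks.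
Definition mean_deg := (kap %/ nblocks).+1.
Definition block_deg := mean_deg + 2 * (mean_deg %/ lam).+1.
Definition mean_size := (n %/ nblocks).+1.
Definition block_size := mean_size + 2 * mean_size.

Let nblocks_gt0 : 0 < nblocks. Proof. by rewrite expn_gt0. Qed.

Let mean_ge : 2 ^ (2 * lam).-1 <= kap %/ nblocks.
Proof.
rewrite leq_divRL // /nblocks -expnD; apply: leq_trans (ltnW kap_gt).
by rewrite leq_exp2l //; lia.
Qed.

(** Makes the allowed deviation, of order [mean_deg / lam], at least [4 * lam * m], as a failure
    probability of n^(-4) requires in [tail_arith]. *)
Let lam_sq : 8 * lam ^ 2 * m <= 2 ^ (2 * lam).
Proof.
apply: (@leq_trans (2 ^ lam * 2 ^ lam)); last by rewrite -expnD; apply: leq_pexp2l; lia.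
apply: leq_mul m_le; apply: leq_trans lam_big.
have : lam ^ 2 <= lam ^ 4 by apply: leq_pexp2l.
lia.
Qed.

Let half_lam : 2 ^ (2 * lam) = 2 * 2 ^ (2 * lam).-1.
Proof. by rewrite -expnS prednK //; lia. Qed.

Lemma nblocks_le : nblocks <= kap.
Proof.
rewrite /nblocks; apply: leq_trans (ltnW kap_gt); apply: leq_pexp2l => //; lia.
Qed.

Lemma block_tail (A : {set 'I_n}) (b mu l j q mm : nat) :
  0 < mu -> 0 < l -> #|A| <= nblocks * mu -> mu + 2 * j <= mm -> mu <= l * j ->
  l * q <= j ->
  #|[set w : space | mm <= #|[set u in A | block (w (pos u)) == b]|]| * 2 ^ q
    <= #|{: space}|.
Proof.
move=> mu0 l0 hA hm hmu hq.
have := @factorial_tail_nat J T _ pos rk seeds_gt0 rk_inj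
  (fun u w => block (w (pos u)) == b) nblocks mm j A nblocks_gt0.
move=> tail; apply: (tail_arith nblocks_gt0 mu0 l0 hA hm hmu hq).
apply: tail => [u v w t uv|v w]; first by rewrite resample_ltn.
under eq_finset => t do rewrite resampleE eqxx.
by apply: card_digit_one; lia.
Qed.

Lemma blocks_whp : exists Bad : {set space}, #|Bad| * n <= #|{: space}| /\
  forall w, w \notin Bad ->
    (forall v b, #|[set u in earlier v | block (w (pos u)) == b]| < block_deg) /\
    (forall b, #|[set v | block (w (pos v)) == b]| < block_size).
Proof.
pose P1 (p : 'I_n * 'I_nblocks) (w : space) :=
  block_deg <= #|[set u in earlier p.1 | block (w (pos u)) == p.2]|.
pose P2 (b : 'I_nblocks) (w : space) :=
  block_size <= #|[set u in [set: 'I_n] | block (w (pos u)) == b]|.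
pose Bad := [set w | [exists p, P1 p w]] :|: [set w | [exists b, P2 b w]].
(* Each event fails with probability at most n^(-4), and there are at most [2 * n ^ 2] events, which
   leaves 1/n. *)
have four : n ^ 4 <= 2 ^ (4 * m) by rewrite mulnC expnM leq_expn2r_weak.
have h1 : #|[set w | [exists p, P1 p w]]| * n ^ 4 <= n * nblocks * #|{: space}|.
  have -> : n * nblocks = #|{: 'I_n * 'I_nblocks}| by rewrite card_prod !card_ord.
  apply: union_bound => -[v b].
  apply: (@leq_trans (#|[set w | P1 (v, b) w]| * 2 ^ (4 * m))).
    by rewrite leq_mul2l four orbT.
  apply: (@block_tail _ _ mean_deg lam (mean_deg %/ lam).+1) => //.
  - apply: leq_trans (earlier_le v) _; rewrite /mean_deg mulnC.
    by apply: ltnW; apply: ltn_ceil.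
  - by rewrite mulnC; apply: ltnW; apply: ltn_ceil.
  rewrite -(leq_pmul2l lam_gt0); apply: (@leq_trans mean_deg); last first.
    by rewrite mulnC; apply: ltnW; apply: ltn_ceil.
  rewrite (_ : lam * (lam * (4 * m)) = 4 * (lam ^ 2 * m)); last by ring.
  by rewrite /mean_deg; move: mean_ge lam_sq; rewrite half_lam -mulnA; lia.
have h2 : #|[set w | [exists b, P2 b w]]| * n ^ 4 <= nblocks * #|{: space}|.
  rewrite -[X in _ <= X * _]card_ord; apply: union_bound => b.
  apply: (@leq_trans (#|[set w | P2 b w]| * 2 ^ (4 * m))).
    by rewrite leq_mul2l four orbT.
  (* Sizes are needed only up to a constant, so the deviation may be twice the mean, which is the
     case [l = 1]. *)
  apply: (@block_tail _ _ mean_size 1 mean_size) => //; rewrite ?mul1n //.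
    rewrite cardsT card_ord /mean_size mulnC.
    by apply: ltnW; apply: ltn_ceil.
  rewrite /mean_size; have := leq_div2r nblocks kap_le.
  have : m <= lam ^ 2 * m by rewrite leq_pmull // expn_gt0 lam_gt0.
  by move: mean_ge lam_sq; rewrite half_lam -mulnA; lia.
exists Bad; split.
  have n3 : 0 < n ^ 3 by rewrite expn_gt0; lia.
  have cB : #|Bad| <= #|[set w | [exists p, P1 p w]]| + #|[set w | [exists b, P2 b w]]|.
    by rewrite cardsU leq_subr.
  rewrite -(leq_pmul2r n3) -mulnA -expnS.
  apply: leq_trans (leq_mul cB (leqnn _)) _; rewrite mulnDl.
  apply: leq_trans (leq_add h1 h2) _.
  rewrite -mulnDl mulnC leq_mul2l; apply/orP; right.
  have le1 : n * nblocks <= n ^ 2.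
    by rewrite expnS expn1 leq_mul2l (leq_trans nblocks_le kap_le) orbT.
  have le2 : nblocks <= n ^ 2.
    by apply: leq_trans (leq_trans nblocks_le kap_le) _; rewrite expnS expn1 leq_pmulr; lia.
  have : 2 * n ^ 2 <= n ^ 3 by rewrite [n ^ 3]expnS leq_mul2r n_gt1 orbT.
  by lia.
move=> w; rewrite !inE negb_or => /andP [/existsPn hP1 /existsPn hP2].
have block_lt (t : T) : block t < nblocks by rewrite ltn_mod.
split=> [v b|b].
  have [bl|bl] := ltnP b nblocks; first by have := hP1 (v, Ordinal bl); rewrite -ltnNge.
  rewrite (_ : [set _ in _ | _] = set0) ?cards0 //.
  apply/setP => u; rewrite !inE; apply/negP => /andP [_ /eqP ub].
  by have := block_lt (w (pos u)); rewrite ub ltnNge bl.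
have [bl|bl] := ltnP b nblocks.
  have := hP2 (Ordinal bl); rewrite -ltnNge; apply: leq_trans; rewrite ltnS.
  by apply: subset_leq_card; apply/subsetP => u; rewrite !inE.
rewrite (_ : [set _ | _] = set0) ?cards0 //.
apply/setP => u; rewrite !inE; apply/negP => /eqP ub.
by have := block_lt (w (pos u)); rewrite ub ltnNge bl.
Qed.

(** Here [i_gt] gives [2 ^ (2 * lam) <= nblocks], so the degree in a block is O([nblocks]), while
    the size of a block is O(n / [nblocks]). *)
Lemma block_load_le : 2 * (block_size * block_deg) <= 120 * n.
Proof.
have l1 : mean_size * nblocks <= 2 * n.
  rewrite /mean_size mulSn; have := leq_trunc_div n nblocks.
  have := leq_trans nblocks_le kap_le; lia.
have l2 : kap %/ nblocks <= 2 ^ (2 * lam).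
  rewrite -(mulnK (2 ^ (2 * lam)) nblocks_gt0); apply: leq_div2r.
  by rewrite -expnD; apply: leq_trans kap_le2 _; apply: leq_pexp2l; lia.
have l3 : 2 ^ (2 * lam) <= nblocks by apply: leq_pexp2l; lia.
have l4 : mean_deg <= 2 * nblocks by rewrite /mean_deg; lia.
have l5 : block_deg <= 10 * nblocks.
  rewrite /block_deg; have := leq_div mean_deg lam; lia.
apply: (@leq_trans (2 * (block_size * (10 * nblocks)))).
  by rewrite leq_mul2l leq_mul2l l5 !orbT.
rewrite (_ : 2 * _ = 60 * (mean_size * nblocks)); last by rewrite /block_size; ring.
by lia.
Qed.

Lemma block_colors_le : lam * (nblocks * block_deg) <= lam * kap + 7 * kap.
Proof.
have l1 : nblocks * mean_deg <= kap + nblocks.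
  by rewrite /mean_deg mulnS addnC leq_add2r mulnC leq_trunc_div.
have l2 : lam * (mean_deg %/ lam) <= mean_deg by rewrite mulnC leq_trunc_div.
have l3 : lam * nblocks <= kap.
  apply: leq_trans (leq_trunc_div kap nblocks); rewrite leq_mul2r; apply/orP; right.
  apply: leq_trans mean_ge; apply: leq_trans (ltnW (ltn_expl lam (isT : 1 < 2))) _.
  by apply: leq_pexp2l; lia.
have l4 := nblocks_le.
rewrite /block_deg; set x := mean_deg %/ lam in l2 *; set y := mean_deg in l1 l2 *.
have : nblocks * (lam * x) <= nblocks * y by rewrite leq_mul2l l2 orbT.
have : lam * (nblocks * y) <= lam * (kap + nblocks) by rewrite leq_mul2l l1 orbT.
rewrite mulnDr.
have -> : lam * (nblocks * (y + 2 * x.+1)) =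
    lam * (nblocks * y) + 2 * (nblocks * (lam * x)) + 2 * (lam * nblocks) by ring.
lia.
Qed.

End Blocks.

(** * Intermediate degeneracy: random lists with a reserve *)

Section Lists.

Hypothesis i_gt : lam < i.
Hypothesis i_le : i <= 4 * lam.
Hypothesis i_lt : i < m.
Hypothesis s_eq : s = 4 * lam * (5 * lam).

(** With 2^(i - lam) reserve groups, a vertex expects at most 2^lam earlier neighbors in its own
    group. *)
Definition group_bits := i - lam.
(** Large enough for [lam * reserve >= 3 * m], which makes 2^(- lam * reserve) at most n^(-3) in
    [lists_whp]. *)
Definition reserve := (3 * m %/ lam).+1.
Definition main_colors := kap + (kap %/ lam).+1.

Local Notation r := group_bits.
Local Notation j := reserve.
Local Notation K := main_colors.
Local Notation a := i.+1.

Let lam_gt1 : 1 < lam.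
Proof.
case: (ltnP 1 lam) => // lam1; have lamE : lam = 1 by lia.
by move: lam_big; rewrite lamE.
Qed.

Let K_le : K <= 2 ^ a.
Proof.
have kap0 : 0 < kap by apply: leq_trans kap_gt.
rewrite expnS mul2n -addnn leq_add //.
exact: leq_trans (ltn_Pdiv lam_gt1 kap0) kap_le2.
Qed.

Definition candidate (w : space) (v : 'I_n) (k : 'I_s) : nat :=
  digit (w (pos v)) k %% 2 ^ a.

Definition choose (w : space) (v : 'I_n) (c : 'I_n -> option nat) : option nat :=
  omap (candidate w v)
    [pick k | (candidate w v k < K) && [forall u in earlier v, c u != Some (candidate w v k)]].

Definition list_greedy w : 'I_n -> option nat := greedy rk None (choose w).

Definition failed (v : 'I_n) (w : space) : bool := list_greedy w v == None.

Lemma choose_ext (w w' : space) (v : 'I_n) (c c' : 'I_n -> option nat) : w (pos v) = w' (pos v) ->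
  (forall u, rk u < rk v -> c u = c' u) -> choose w v c = choose w' v c'.
Proof.
move=> ww cc; rewrite /choose /candidate ww; congr (omap _ _); apply: eq_pick => k.
congr (_ && _); apply: eq_forallb => u; rewrite inE.
by case: (e v u) => //=; case: (ltnP (rk u) (rk v)) => // /cc ->.
Qed.

Lemma list_greedyE w v : list_greedy w v = choose w v (list_greedy w).
Proof. by apply: greedyE => c c' cc; apply: choose_ext. Qed.

(** The greedy color of [u] is determined by the seeds up to [u], so getting stuck is a
    nonanticipating event and [factorial_tail_nat] applies despite the dependence. *)
Lemma list_greedy_resample w u v t : rk u < rk v ->
  list_greedy (resample w (pos v) t) u = list_greedy w u.
Proof.
move=> uv; rewrite /list_greedy /greedy.
have main k x : k <= rk v -> greedy_upto rk None (choose (resample w (pos v) t)) k x =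
    greedy_upto rk None (choose w) k x.
  elim: k x => //= k IH x kv; case: eqP => [xk|_]; last by apply: IH; apply: ltnW.
  apply: choose_ext => [|y _]; last by apply: IH; apply: ltnW.
  by apply: resample_ltn; rewrite xk.
exact: main.
Qed.

Lemma list_greedy_some w v z : list_greedy w v = Some z ->
  [/\ z < K, exists k, z = candidate w v k &
      forall u, u \in earlier v -> list_greedy w u <> Some z].
Proof.
rewrite list_greedyE /choose; case: pickP => // k /andP [zK /forallP free] [<-].
split=> //; first by exists k.
by move=> u uv; apply/eqP; have := free u; rewrite uv.
Qed.

(** With all other seeds fixed, [v] gets stuck only if all its [s] independent digits hit forbidden
    residues. *)
Lemma card_failed v w :
  #|[set t | failed v (resample w (pos v) t)]| * 2 ^ (5 * lam) <= #|{: T}|.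
Proof.
pose P z := ~~ ((z < K) && [forall u in earlier v, list_greedy w u != Some z]).
set Z := [set z : 'I_(2 ^ a) | P z].
(* At most [kap] of the main colors are taken by earlier neighbors, so the surplus of the main
   palette stays free. *)
have cardZ : #|Z| + (kap %/ lam).+1 <= 2 ^ a.
  have : K <= #|~: Z| + #|earlier v|.
    rewrite -{1}(size_iota 0 K) !cardE.
    pose l := map val (enum (~: Z)) ++ pmap (list_greedy w) (enum (earlier v)).
    apply: (@leq_trans (size l)).
      apply: uniq_leq_size (iota_uniq _ _) _ => z; rewrite mem_iota /= add0n => zK.
      rewrite mem_cat; case Pz: (P z).
        apply/orP; right; move: Pz; rewrite /P zK /= => /existsP [u].
        rewrite negb_imply negbK => /andP [uv /eqP gu].
        by rewrite mem_pmap -gu map_f // mem_enum.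
      apply/orP; left; apply/mapP; exists (Ordinal (leq_trans zK K_le)) => //.
      by rewrite mem_enum !inE Pz.
    rewrite size_cat size_map leq_add2l size_pmap.
    exact: count_size.
  have := cardsC Z; rewrite card_ord; have := earlier_le v; rewrite /main_colors; lia.
(* As [2 ^ a < 4 * kap], the free residues have density at least 1 / (4 lam); the choice of [s] then
   yields 2^(-5 lam) through [pow_gap]. *)
have fourZ : 4 * lam * #|Z| <= (4 * lam).-1 * 2 ^ a.
  have c1 : kap < (kap %/ lam).+1 * lam by apply: ltn_ceil.
  have c2 : 2 ^ a < 4 * kap.
    have -> : 2 ^ a = 4 * 2 ^ i.-1 by rewrite -(expnD 2 2); congr (2 ^ _); lia.
    by rewrite ltn_pmul2l.
  have c3 : 4 * lam * (#|Z| + (kap %/ lam).+1) <= 4 * lam * 2 ^ a.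
    by rewrite leq_mul2l cardZ orbT.
  have -> : (4 * lam).-1 * 2 ^ a = 4 * lam * 2 ^ a - 2 ^ a by rewrite -subn1 mulnBl mul1n.
  move: c3; rewrite mulnDr (_ : 4 * lam * _.+1 = 4 * ((kap %/ lam).+1 * lam)); last by ring.
  lia.
have powZ : #|Z| ^ s * 2 ^ (5 * lam) <= (2 ^ a) ^ s.
  have q0 : 0 < (4 * lam) ^ s by rewrite expn_gt0; lia.
  rewrite -(leq_pmul2r q0).
  have -> : #|Z| ^ s * 2 ^ (5 * lam) * (4 * lam) ^ s = (4 * lam * #|Z|) ^ s * 2 ^ (5 * lam).
    by rewrite [in RHS]expnMn [(4 * lam) ^ s * _]mulnC mulnAC.
  apply: leq_trans (leq_mul (leq_expn2r_weak _ fourZ) (leqnn _)) _.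
  rewrite expnMn mulnAC mulnC leq_mul2l; apply/orP; right.
  have l0 : 0 < (4 * lam).-1 by lia.
  have lq : (4 * lam).-1 * (5 * lam) <= s by rewrite s_eq leq_mul2r leq_pred orbT.
  rewrite mulnC; apply: leq_trans (pow_gap l0 lq) _.
  by rewrite prednK //; lia.
have p0 : 0 < (2 ^ a) ^ s by rewrite !expn_gt0.
rewrite -(leq_pmul2r p0) mulnAC.
apply: (@leq_trans (#|{: T}| * #|Z| ^ s * 2 ^ (5 * lam))); last first.
  by rewrite -mulnA leq_mul2l powZ orbT.
rewrite leq_mul2r; apply/orP; right.
apply: leq_trans (card_digit_all s P i_lt); rewrite leq_mul2r; apply/orP; right.
apply: subset_leq_card; apply/subsetP => t; rewrite !inE /failed list_greedyE /choose.
case: pickP => // none _; apply/forallP => k.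
apply/negP => /andP [zK /forallP free]; move/negbT/negP: (none k); apply.
rewrite /candidate resampleE eqxx zK; apply/forallP => u; apply/implyP => uv.
rewrite list_greedy_resample; first by have := free u; rewrite uv.
by move: uv; rewrite inE => /andP [].
Qed.

Definition clashes (v : 'I_n) (w : space) : nat :=
  #|[set u in earlier v | list_clash k0 r a (w (pos v)) (w (pos u))]|.

(** The reserve groups contribute at most 2^lam on average, and so do the main colors, because
    [s * s = 400 * lam ^ 4] is at most [2 ^ lam]. *)
Lemma sum_clashes v w :
  \sum_t clashes v (resample w (pos v) t) <= #|{: T}| * 2 ^ lam.+1.
Proof.
have -> : \sum_t clashes v (resample w (pos v) t) =
    \sum_(u in earlier v) #|[set t | list_clash k0 r a t (w (pos u))]|.
  rewrite (eq_bigr (fun t => \sum_(u in earlier v)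
    (list_clash k0 r a t (w (pos u)) : nat))) => [|t _]; last first.
    rewrite /clashes -sum1_card [RHS]big_mkcond [LHS]big_mkcond /=.
    apply: eq_bigr => u _; rewrite inE; case: (boolP (u \in earlier v)) => //= uv.
    rewrite resampleE eqxx resample_ltn; first by case: (list_clash _ _ _ _ _).
    by move: uv; rewrite inE => /andP [].
  rewrite exchange_big /=; apply: eq_bigr => u _.
  rewrite -sum1_card [RHS]big_mkcond /=; apply: eq_bigr => t _.
  by rewrite inE; case: (list_clash _ _ _ _ _).
have p0 : 0 < 2 ^ a by rewrite expn_gt0.
rewrite -(leq_pmul2r p0) big_distrl /=.
apply: (@leq_trans (\sum_(u in earlier v) #|{: T}| * (2 ^ (a - r) + s * s))).
  by apply: leq_sum => u _; apply: card_list_clash; rewrite /group_bits; lia.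
rewrite sum_nat_const mulnCA -mulnA leq_mul2l; apply/orP; right.
have -> : a - r = lam.+1 by rewrite /group_bits; lia.
have ss : s * s <= 2 ^ lam.+1.
  apply: (@leq_trans (2 ^ lam)); last by apply: leq_pexp2l.
  apply: leq_trans lam_big; rewrite s_eq.
  by rewrite (_ : _ * _ = 400 * lam ^ 4) //; ring.
apply: leq_trans (leq_mul (leq_trans (earlier_le v) kap_le2) (leq_add (leqnn _) ss)) _.
by rewrite addnn -mul2n mulnCA mulnA -expnS mulnC.
Qed.

(** Among at most 2^(4 lam) earlier neighbors, each stuck with probability 2^(-5 lam), [j] stuck
    ones occur with probability at most 2^(- lam j). The number of clashing edges is controlled by
    [exponential_tail] with exponent [2 * m]. *)
Lemma lists_whp : exists Bad : {set space}, #|Bad| * n <= #|{: space}| /\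
  forall w, w \notin Bad ->
    (forall v, #|[set u in earlier v | failed u w]| < j) /\
    \sum_v clashes v w < 4 * 2 ^ lam.+1 * n.
Proof.
pose P1 (v : 'I_n) (w : space) := j <= #|[set u in earlier v | failed u w]|.
pose A1 := [set w | [exists v, P1 v w]].
pose A2 := [set w : space | 4 * 2 ^ lam.+1 * n <= \sum_v clashes v w].
have h1 : #|A1| * n ^ 3 <= n * #|{: space}|.
  rewrite -[X in _ <= X * _]card_ord; apply: union_bound => v.
  have n3 : n ^ 3 <= 2 ^ (lam * j).
    apply: (@leq_trans (2 ^ (3 * m))); first by rewrite mulnC expnM leq_expn2r_weak.
    by apply: leq_pexp2l => //; rewrite [lam * _]mulnC; apply: ltnW; apply: ltn_ceil.
  apply: (@leq_trans (#|[set w | P1 v w]| * 2 ^ (lam * j))).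
    by rewrite leq_mul2l n3 orbT.
  have tail := @factorial_tail_nat J T _ pos rk seeds_gt0 rk_inj
    failed (2 ^ (5 * lam)) j j (earlier v).
  have {}tail : #|[set w | P1 v w]| * (j ^_ j * (2 ^ (5 * lam)) ^ j) <=
      #|{: space}| * #|earlier v| ^ j.
    apply: tail (card_failed); first by rewrite expn_gt0.
    by move=> u x w t ux; rewrite /failed list_greedy_resample.
  have p0 : 0 < (2 ^ (4 * lam)) ^ j by rewrite !expn_gt0.
  rewrite -(leq_pmul2r p0) -mulnA.
  have -> : 2 ^ (lam * j) * (2 ^ (4 * lam)) ^ j = (2 ^ (5 * lam)) ^ j.
    by rewrite -!expnM -expnD; congr (2 ^ _); ring.
  apply: (@leq_trans (#|{: space}| * #|earlier v| ^ j)); last first.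
    rewrite leq_mul2l; apply/orP; right; apply: leq_expn2r_weak.
    apply: leq_trans (earlier_le v) (leq_trans kap_le2 _); exact: leq_pexp2l.
  apply: leq_trans tail; rewrite leq_mul2l; apply/orP; right.
  by rewrite leq_pmull // ffact_gt0.
have h2 : #|A2| * n ^ 2 <= #|{: space}|.
  apply: (@leq_trans (#|A2| * 2 ^ (2 * m))).
    by rewrite leq_mul2l [2 * m]mulnC expnM leq_expn2r_weak ?orbT.
  have kap0 : 0 < kap by apply: leq_trans kap_gt.
  have := @exponential_tail J T _ pos rk seeds_gt0 rk_inj clashes kap (2 ^ lam.+1) (2 * m).
  rewrite card_ord; apply=> //.
  - by rewrite expnS; apply: leq_mul => //; rewrite leq_mul2l m_le orbT.
  - move=> u v w t uv; rewrite /clashes; apply: eq_card => x; rewrite !inE.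
    case: (e u x) => //=; case: (ltnP (rk x) (rk u)) => //= xu.
    by rewrite !resample_ltn // (ltn_trans xu).
  - move=> v w; apply: leq_trans (earlier_le v); apply: subset_leq_card.
    by apply/subsetP => u; rewrite inE => /andP [].
  exact: sum_clashes.
exists (A1 :|: A2); split.
  have n2 : 0 < n ^ 2 by rewrite expn_gt0; lia.
  have h1' : #|A1| * n ^ 2 <= #|{: space}|.
    have n0 : 0 < n by lia.
    by rewrite -(leq_pmul2l n0) mulnCA -expnS.
  have cB : #|A1 :|: A2| <= #|A1| + #|A2| by rewrite cardsU leq_subr.
  have n1 : 2 * n <= n ^ 2 by rewrite expnS expn1 leq_mul2r n_gt1 orbT.
  have : #|A1 :|: A2| * (2 * n) <= 2 * #|{: space}|.
    apply: leq_trans (leq_mul cB n1) _; rewrite mulnDl mul2n -addnn.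
    exact: leq_add.
  by rewrite mulnCA leq_mul2l.
move=> w; rewrite !inE negb_or -ltnNge => /andP [/existsPn hP1 hP2].
by split=> // v; have := hP1 v; rewrite -ltnNge.
Qed.

(** The graph on the stuck vertices has fewer than [j] earlier neighbors at each vertex, so it has
    one proper coloring [psi] with [j] colors; each stuck vertex takes color [psi] of its own
    reserve group. *)
Lemma list_coloring w :
  (forall v, #|[set u in earlier v | failed u w]| < j) ->
  exists chi : 'I_n -> nat,
  (forall v, chi v < 2 ^ r * j + K /\ list_palette k0 r j a (w (pos v)) (chi v)) /\
  forall u v, e u v -> chi u <> chi v.
Proof.
move=> few.
pose eU : rel 'I_n := fun u v => [&& e u v, failed u w & failed v w].
have [||v|psi [psi_lt psiP]] := @ordered_coloring _ eU rk j rk_inj.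
- by move=> u v; rewrite /eU e_sym; congr (_ && _); apply: andbC.
- by move=> u; rewrite /eU e_irr.
- apply: leq_ltn_trans (few v); apply: subset_leq_card; apply/subsetP => u.
  by rewrite !inE /eU => /andP [/and3P [-> _ ->] ->].
have j0 : 0 < j by [].
pose grp v := digit (w (pos v)) k0 %% 2 ^ r.
have grp_lt v : grp v < 2 ^ r by rewrite ltn_mod expn_gt0.
pose chi v := if list_greedy w v is Some z then 2 ^ r * j + z else grp v * j + psi v.
have chi_res v : grp v * j + psi v < 2 ^ r * j.
  apply: (@leq_trans ((grp v).+1 * j)); last by rewrite leq_mul2r grp_lt orbT.
  by rewrite mulSn addnC ltn_add2r.
have chi_div v : (grp v * j + psi v) %/ j = grp v.
  by rewrite divnMDl // divn_small ?addn0.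
exists chi; split=> [v|].
  rewrite /chi /list_palette; case gv: (list_greedy w v) => [z|].
    have [zK [k zk] _] := list_greedy_some gv.
    rewrite ltn_add2l zK; split=> //; apply/orP; right; apply/existsP; exists k.
    by rewrite zk.
  by rewrite chi_res chi_div eqxx; split=> //; apply: leq_trans (chi_res v) (leq_addr _ _).
have main u v : e u v -> rk u < rk v -> chi u <> chi v.
  move=> euv uv; rewrite /chi.
  case gu: (list_greedy w u) => [z|]; case gv: (list_greedy w v) => [z'|].
  - move/addnI => zz; have [_ _ /(_ u)] := list_greedy_some gv.
    by rewrite inE e_sym euv uv gu zz => /(_ isT).
  - by move=> eqc; have := chi_res v; rewrite -eqc ltnNge leq_addr.
  - by move=> eqc; have := chi_res u; rewrite eqc ltnNge leq_addr.
  move=> eqc; have eqg : grp u = grp v by rewrite -(chi_div u) eqc chi_div.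
  move: eqc; rewrite eqg => /addnI; apply: psiP.
  by rewrite /eU euv /failed gu gv.
move=> u v euv; case: (ltngtP (rk u) (rk v)) => [uv|vu|/rk_inj eqv].
- exact: main.
- by move/esym; apply: main => //; rewrite e_sym.
by move: euv; rewrite eqv e_irr.
Qed.

Lemma list_colors_le : lam * (2 ^ r * j + K) <= lam * kap + 10 * kap.
Proof.
have l1 : lam * j <= 3 * m + lam.
  by rewrite /reserve mulnS addnC leq_add2r mulnC leq_trunc_div.
have l2 : lam * (kap %/ lam) <= kap by rewrite mulnC leq_trunc_div.
have l3 : 2 ^ r * 2 ^ lam < 2 * kap.
  rewrite -expnD (_ : r + lam = i); last by rewrite /group_bits; lia.
  rewrite -(prednK (_ : 0 < i)); last by lia.
  by rewrite expnS ltn_pmul2l.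
have l4 : lam <= 2 ^ lam by apply: ltnW; apply: ltn_expl.
have l5 : 2 ^ r * m <= 2 ^ r * 2 ^ lam by rewrite leq_mul2l m_le orbT.
have l6 : 2 ^ r * lam <= 2 ^ r * 2 ^ lam by rewrite leq_mul2l l4 orbT.
have l7 : lam <= kap.
  apply: leq_trans l4 (leq_trans _ (ltnW kap_gt)); apply: leq_pexp2l => //; lia.
have l8 : 2 ^ r * (lam * j) <= 2 ^ r * (3 * m + lam) by rewrite leq_mul2l l1 orbT.
rewrite /main_colors.
have -> : lam * (2 ^ r * j + (kap + (kap %/ lam).+1)) =
   2 ^ r * (lam * j) + lam * kap + lam * (kap %/ lam) + lam by ring.
move: l8; rewrite mulnDr [2 ^ r * (3 * m)]mulnCA; lia.
Qed.

End Lists.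

End Analysis.

(** * The schemes *)

Lemma color_cap_ge n : 1 < n -> 512 * n <= color_cap n.
Proof.
move=> n1; rewrite /color_cap [10 * _]mulnC expnM.
apply: (@leq_trans (n ^ 10)); last by apply: leq_expn2r_weak; apply: leq_exp_lg.
by rewrite expnSr leq_mul2r (leq_expn2r_weak 9 n1) orbT.
Qed.

(** The schemes exceed [k] by at most [10 * k / lam]; replacing [lam] by [(lg (lg k)).+1], which is
    at most [2 * lam], doubles the constant and removes [n]. The final 1 allows for the [k.+1]
    colors of a plain greedy coloring. *)
Definition excess (k : nat) : nat := 20 * k %/ (lg (lg k)).+1 + 1.

Lemma excess_ge lam k x : 0 < lam -> lg (lg k) <= lam ->
  lam * x <= lam * k + 10 * k -> x <= k + excess k.
Proof.
move=> lam0 le_lam hx; rewrite -leq_subLR /excess addn1 ltnW // ltnS leq_divRL //.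
rewrite -(leq_pmul2l lam0) mulnA mulnBr.
have h : lam * x - lam * k <= 10 * k by lia.
apply: leq_trans (leq_mul h (_ : _ <= 2 * lam)) _; first by lia.
by rewrite (_ : 10 * k * (2 * lam) = lam * (20 * k)) //; ring.
Qed.

Lemma excess_mul_le N k : 2 ^ (2 ^ N) <= k -> (excess k).-1 * N <= 20 * k.
Proof.
move=> hk; rewrite /excess addn1 /=.
apply: leq_trans (leq_trunc_div (20 * k) (lg (lg k)).+1).
rewrite leq_mul2l; apply/orP; right; apply: leqW.
have := leq_up_log 2 hk; rewrite up_expnK // => /(leq_up_log 2).
by rewrite up_expnK.
Qed.

Lemma excess_little_o : little_o_id excess.
Proof.
move=> eps eps0.
have archi (c : rat) : (0 <= c)%R -> exists N : nat, (c <= eps * N.+1%:R)%R.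
  move=> c0; exists (Num.bound (c / eps))%R.
  have := archi_boundP (divr_ge0 c0 (ltW eps0)) => /ltW.
  rewrite ler_pdivrMr // mulrC => /le_trans; apply.
  by apply: ler_wpM2l; rewrite ?ler_nat // ltW.
have [N hN] := archi _ (ler0n _ 40).
(* The first bound forces [lg (lg k)] up to [N.+1]; the second absorbs the additive 1, for which 40
   instead of 20 leaves room. *)
exists (maxn (2 ^ (2 ^ N.+1)) N.+1) => k; rewrite geq_max => /andP [k_exp k_N].
have N0 : (0 < N.+1%:R :> rat)%R by rewrite ltr0Sn.
have le1 : ((excess k).-1%:R * N.+1%:R <= 20%:R * k%:R :> rat)%R.
  by rewrite -!natrM ler_nat excess_mul_le.
have exS : excess k = (excess k).-1.+1 by rewrite /excess addn1.
rewrite exS -(ler_pM2r N0) -natr1 mulrDl mul1r [(eps * _ * _)%R]mulrAC.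
have kNr : (N.+1%:R <= k%:R :> rat)%R by rewrite ler_nat.
have k_ge0 : (0 <= k%:R :> rat)%R by rewrite ler0n.
have := ler_wpM2r k_ge0 hN; move: le1 kNr (k_ge0); clear; lra.
Qed.

(** * A single leader for all vertices *)

Section WholeGraph.

Variables (n : nat) (Sc : scheme n) (B : nat) (e : rel 'I_n).
Hypothesis n_gt1 : 1 < n.
Hypothesis e_sym : symmetric e.
Hypothesis e_irr : irreflexive e.
Variables (w : {ffun 'I_n -> (seed_len Sc).-tuple bool}) (i : 'I_(scales Sc)) (q0 : 'I_n).
Hypothesis home_q0 : forall x, home i x = q0.

Lemma sum_point_le (P : pred 'I_n) x : \sum_(q | P q) (if q == q0 then x else 0) <= x.
Proof.
rewrite -big_mkcondr /=; apply: (@leq_trans (\sum_(q | q == q0) x)).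
  rewrite [X in _ <= X](bigID P) /= [X in X <= _](eq_bigl (fun q => (q == q0) && P q)) ?leq_addr //.
  by move=> q; rewrite andbC.
by rewrite big_pred1_eq.
Qed.

Lemma good_single_leader (chi : 'I_n -> nat) (h : nat) :
  #|[set p : 'I_n * 'I_n | e p.1 p.2 && clash i (w p.1) (w p.2)]| <= B ->
  (forall v, chi v < h /\ palette i (w v) (chi v)) ->
  (forall u v, e u v -> chi u <> chi v) ->
  h < color_cap n -> good_seeds B e w h.
Proof.
move=> hB hchi proper hcap; exists i, (fun q => if q == q0 then h else 0), chi.
split=> [q|v|u v euv _|q|].
- apply: leq_trans hB; apply: subset_leq_card; apply/subsetP => p.
  by rewrite !inE => /and4P [-> _ _ ->].
- have [h1 h2] := hchi v; rewrite home_q0 eqxx; split=> //.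
  exact: ltn_trans h1 hcap.
- exact: proper.
- by case: eqP => // _; apply: color_cap_gt0.
exact: sum_point_le.
Qed.

Lemma good_whole_graph (kap : nat) (rk : 'I_n -> nat) :
  injective rk -> (forall v, #|earlier e rk v| <= kap) -> kap < n ->
  (forall x c, palette i x c) -> 2 * (n * kap) <= B -> good_seeds B e w kap.+1.
Proof.
move=> rk_inj out_le kap_lt full hB.
have [chi [chi_lt chiP]] := @ordered_coloring _ e rk kap.+1 rk_inj e_sym e_irr
  (fun v => out_le v).
apply: (good_single_leader (chi := chi)) => //; last first.
  by have := color_cap_ge n_gt1; lia.
apply: leq_trans hB.
apply: (@leq_trans #|[set p : 'I_n * 'I_n | e p.1 p.2 && true]|).
  by apply: subset_leq_card; apply/subsetP => p; rewrite !inE => /andP [->].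
apply: leq_trans (@card_edges_le _ e (fun _ _ => true) rk rk_inj e_sym e_irr _) _ => //.
rewrite leq_mul2l /= -[X in _ <= X * _]card_ord -sum_nat_const.
apply: leq_sum => v _; apply: leq_trans (out_le v); apply: subset_leq_card.
by apply/subsetP => u; rewrite inE => /andP [].
Qed.

End WholeGraph.

Section WholeScheme.

Variable n : nat.

Definition whole_scale_of (q : 'I_n.+1) : option 'I_1 :=
  if q == ord0 then Some ord0 else None.

Lemma whole_scale_of_home (i : 'I_1) (x : 0.-tuple bool) :
  whole_scale_of ord0 = Some i.
Proof. by rewrite /whole_scale_of eqxx (ord1 i). Qed.

(** Serves the boundedly many [n] that are too small for the asymptotic inequalities; it draws no
    random bits. *)
Definition whole_scheme : scheme n.+1 :=
  @Scheme n.+1 0 1 (fun _ _ => ord0) (fun _ _ _ => true) (fun _ _ _ => true)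
    whole_scale_of whole_scale_of_home (fun _ _ _ _ _ _ => isT).

End WholeScheme.

(** * The scheme for large n *)

Section LayeredScheme.

Variable n' : nat.
Local Notation n := n'.+1.
Local Notation m := (lg n).
Local Notation lam := (lg (lg n)).
Local Notation s := (4 * lam * (5 * lam)).

Hypothesis lam_gt0 : 0 < lam.
Hypothesis lam_big : 400 * lam ^ 4 <= 2 ^ lam.

Local Notation T := ((s * m).-tuple bool).

Lemma digits_gt0 : 0 < s. Proof. by rewrite !muln_gt0 lam_gt0. Qed.
Local Notation k0 := (Ordinal digits_gt0).

Let m_gt1 : 1 < m.
Proof. by move: lam_gt0; rewrite {1}/lg up_log_gt0. Qed.

Let n_gt1 : 1 < n.
Proof. by move: (ltnW m_gt1); rewrite {1}/lg up_log_gt0. Qed.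

Let m_gt : 2 ^ lam.-1 < m. Proof. exact: up_log_gtn. Qed.

(** Keeps the seed length [s * m] within [m ^ 2] bits. *)
Let s_lt : s < m.
Proof.
apply: leq_ltn_trans m_gt.
have p0 : 0 < 2 by [].
rewrite -(leq_pmul2l p0) -expnS prednK //; apply: leq_trans lam_big.
have : lam ^ 2 <= lam ^ 4 by apply: leq_pexp2l.
have -> : 2 * s = 40 * lam ^ 2 by ring.
lia.
Qed.

Let lam_lt : 4 * lam < m.
Proof. by apply: leq_ltn_trans s_lt; rewrite leq_pmulr // muln_gt0. Qed.

(** A scale up to [4 * lam] is led by the processor of that number. A larger one occupies the
    interval from [nblocks] to [2 * nblocks], with [nblocks] a power of 2 above [4 * lam], so the
    binary logarithm of a leader reveals its scale. *)
Definition layer_index (i : nat) (t : T) : nat :=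
  if i <= 4 * lam then i else nblocks lam i + block lam k0 i t.

Lemma layer_index_lt i t : i <= m -> layer_index i t < n.
Proof.
move=> im; have n2 := up_log_gtn (isT : 1 < 2) n_gt1; rewrite -/(lg n) in n2.
rewrite /layer_index; case: (leqP i (4 * lam)) => [i4|i4].
  by move: i4 n2 lam_lt (ltn_expl m.-1 (isT : 1 < 2)); lia.
apply: leq_trans (n2).
apply: (@leq_trans (nblocks lam i + nblocks lam i)).
  by rewrite ltn_add2l ltn_mod expn_gt0.
apply: leq_trans (leqnSn _); rewrite addnn -mul2n /nblocks -expnS; apply: leq_pexp2l => //.
by lia.
Qed.

Definition layer_home (i : 'I_m.+1) (t : T) : 'I_n := inord (layer_index i t).

Lemma layer_homeE i t : layer_home i t = layer_index i t :> nat.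
Proof. by rewrite /layer_home inordK // layer_index_lt // -ltnS. Qed.

Definition uses_lists (i : nat) : bool := (lam < i) && (i <= 4 * lam).

Definition layer_palette (i : 'I_m.+1) (t : T) (c : nat) : bool :=
  if uses_lists i then list_palette k0 (group_bits lam i) (reserve lam m) i.+1 t c
  else true.

Definition layer_clash (i : 'I_m.+1) (t t' : T) : bool :=
  if uses_lists i then list_clash k0 (group_bits lam i) i.+1 t t' else true.

(* For a processor that leads no block the value is junk (possibly an out of range
   [inord]); such a processor has an empty block and uses no color. *)
Definition layer_scale_of (q : 'I_n) : option 'I_m.+1 :=
  Some (inord (if q <= 4 * lam then val q else trunc_log 2 q + 2 * lam)).

Lemma layer_scale_of_home i t : layer_scale_of (layer_home i t) = Some i.
Proof.
rewrite /layer_scale_of /= layer_homeE /layer_index.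
case: (leqP i (4 * lam)) => i4; first by rewrite i4 inord_val.
have big : 4 * lam < nblocks lam i.
  have lt2 := ltn_expl (2 * lam) (isT : 1 < 2).
  have : 2 ^ (2 * lam).+1 <= nblocks lam i by apply: leq_pexp2l; lia.
  by rewrite expnS; lia.
have blk : block lam k0 i t < nblocks lam i by rewrite ltn_mod expn_gt0.
rewrite ifF; last by apply/negbTE; rewrite -ltnNge; apply: leq_trans big (leq_addr _ _).
rewrite (@trunc_log_eq 2 (i - 2 * lam)) //; last first.
  by rewrite leq_addr expnS mul2n -addnn ltn_add2l.
by rewrite subnK ?inord_val //; lia.
Qed.

Lemma layer_clash_palette i t t' c :
  layer_palette i t c -> layer_palette i t' c -> layer_clash i t t'.
Proof.
rewrite /layer_palette /layer_clash; case: (uses_lists i) => //.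
exact: list_clash_palette.
Qed.

Definition layered_scheme : scheme n :=
  @Scheme n (s * m) m.+1 layer_home layer_palette layer_clash layer_scale_of
    layer_scale_of_home layer_clash_palette.

Lemma seed_len_layered : seed_len layered_scheme <= m ^ 2.
Proof. by rewrite /= expnS expn1 leq_mul2r ltnW ?orbT. Qed.

Section Whp.

Variables (B : nat) (J : finType) (pos : 'I_n -> J) (e : rel 'I_n).
Hypothesis B_ge : 120 * (n * m) <= B.
Hypothesis pos_inj : injective pos.
Hypothesis e_sym : symmetric e.
Hypothesis e_irr : irreflexive e.

Local Notation kap := (degeneracy e).
Local Notation space := {ffun J -> T}.

Lemma good_seeds_mono (Sc : scheme n) w K K' : K <= K' ->
  good_seeds (Sc := Sc) B e w K -> good_seeds B e w K'.
Proof.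
move=> KK [i [h [chi [h1 h2 h3 h4 h5]]]]; exists i, h, chi; split=> //.
exact: leq_trans KK.
Qed.

Let kap_lt : kap < n.
Proof. by have := degeneracy_le e_irr; rewrite card_ord. Qed.

Let i0 := lg kap.

Let i0_le : i0 < m.+1.
Proof. by rewrite ltnS; apply: leq_up_log; apply: ltnW. Qed.

Let i := Ordinal i0_le.

Let pow_lam : 2 ^ lam < 2 * m.
Proof. by rewrite -(prednK lam_gt0) expnS ltn_pmul2l. Qed.

Let nm_le x y : x <= 120 * y -> y <= n * m -> x <= B.
Proof. by move=> hx hy; apply: leq_trans hx (leq_trans _ B_ge); rewrite leq_mul2l hy orbT. Qed.

Variable rk : 'I_n -> nat.
Hypothesis rk_inj : injective rk.
Hypothesis out_le : forall v, #|earlier e rk v| <= kap.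

Lemma small_cap x : lam * x <= lam * kap + 10 * kap -> x < color_cap n.
Proof.
move=> hx; have x11 : x <= 11 * kap.
  rewrite -(leq_pmul2l lam_gt0); apply: leq_trans hx _.
  rewrite mulnCA; have : kap <= lam * kap by rewrite leq_pmull.
  lia.
have := color_cap_ge n_gt1; move: kap_lt; lia.
Qed.

Lemma log_log_le : lg (lg kap) <= lam.
Proof. by apply: leq_up_log; apply: leq_up_log; apply: ltnW. Qed.

Lemma layered_whole (w : {ffun 'I_n -> T}) : i0 <= lam ->
  good_seeds (Sc := layered_scheme) B e w (kap + excess kap).
Proof.
move=> i_le.
have i4 : i0 <= 4 * lam by lia.
apply: (@good_seeds_mono _ _ kap.+1); first by rewrite /excess addnA addn1 ltnS leq_addr.
have kap_pow : kap <= 2 ^ lam.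
  by apply: leq_trans (leq_exp_lg kap) _; apply: leq_pexp2l.
apply: (@good_whole_graph n layered_scheme B e n_gt1 e_sym e_irr w i (inord i0) _ kap rk) => //.
- by move=> x; apply: val_inj; rewrite /= /layer_home /layer_index i4.
- by move=> x c; rewrite /= /layer_palette /uses_lists /= ltnNge i_le.
apply: (@nm_le _ (n * m)) => //.
apply: (@leq_trans (2 * (n * (2 * m)))).
  by rewrite !leq_mul2l (leq_trans kap_pow (ltnW pow_lam)) !orbT.
by rewrite [n * (2 * m)]mulnCA mulnA leq_mul2r orbT.
Qed.

Let kap_gt1 : lam < i0 -> 1 < kap.
Proof. by move=> lami; have := leq_ltn_trans (leq0n _) lami; rewrite /i0 /lg up_log_gt0. Qed.

Lemma layered_lists : uses_lists i0 ->
  exists Bad : {set space}, #|Bad| * n <= #|{: space}| /\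
  forall w, w \notin Bad ->
    good_seeds (Sc := layered_scheme) B e [ffun v => w (pos v)] (kap + excess kap).
Proof.
move=> ul; have /andP [i_gt i_le] := ul.
have /andP [kap_gt kap_le2] := up_log_bounds (isT : 1 < 2) (kap_gt1 i_gt).
have i_lt : i0 < m by apply: leq_ltn_trans i_le lam_lt.
have m_le := leq_exp_lg m.
have colors := list_colors_le n_gt1 lam_gt0 lam_big (leq_exp_lg n) m_le (ltnW kap_lt)
  kap_gt kap_le2 i_gt i_le i_lt (erefl s).
have [Bad [cBad hBad]] := lists_whp pos_inj n_gt1 lam_gt0 lam_big (leq_exp_lg n) m_le
  k0 rk_inj out_le (ltnW kap_lt) kap_gt kap_le2 i_gt i_le i_lt (erefl s).
exists Bad; split=> // w /hBad [few load_lt].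
have [chi [chi_ok chiP]] := list_coloring k0 e_sym e_irr rk_inj few.
apply: good_seeds_mono (excess_ge lam_gt0 log_log_le colors) _.
apply: (@good_single_leader n layered_scheme B e _ i (inord i0) _ chi) => //.
- by move=> x; apply: val_inj; rewrite /= /layer_home /layer_index i_le.
- rewrite /= /layer_clash /= ul.
  under eq_finset => p do rewrite !ffunE.
  apply: leq_trans (@card_edges_le _ e (fun u v =>
    list_clash k0 (group_bits lam i0) i0.+1 (w (pos u)) (w (pos v))) rk rk_inj e_sym e_irr _) _.
    by move=> u v; apply: list_clash_sym.
  apply: (@nm_le _ (n * m)) => //.
  apply: (@leq_trans (2 * (4 * 2 ^ lam.+1 * n))); first by rewrite leq_mul2l /= ltnW.
  rewrite expnS.
  have : n * 2 ^ lam <= n * (2 * m) by rewrite leq_mul2l ltnW ?orbT.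
  rewrite [n * (2 * m)]mulnCA.
  by rewrite (_ : 2 * (4 * (2 * 2 ^ lam) * n) = 16 * (n * 2 ^ lam)); [lia | ring].
- by move=> v; rewrite /= /layer_palette ul ffunE; apply: chi_ok.
exact: small_cap colors.
Qed.

Lemma layered_blocks : 4 * lam < i0 ->
  exists Bad : {set space}, #|Bad| * n <= #|{: space}| /\
  forall w, w \notin Bad ->
    good_seeds (Sc := layered_scheme) B e [ffun v => w (pos v)] (kap + excess kap).
Proof.
move=> i4.
have i_gt : lam < i0 by lia.
have /andP [kap_gt kap_le2] := up_log_bounds (isT : 1 < 2) (kap_gt1 i_gt).
have i_le : i0 <= m by [].
have m_le := leq_exp_lg m.
have colors := block_colors_le n_gt1 lam_gt0 lam_big (leq_exp_lg n) m_le (ltnW kap_lt)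
  kap_gt kap_le2 i4 i_le.
have loads := block_load_le n_gt1 lam_gt0 lam_big (leq_exp_lg n) m_le (ltnW kap_lt)
  kap_gt kap_le2 i4 i_le.
have [Bad [cBad hBad]] := blocks_whp pos_inj n_gt1 lam_gt0 lam_big (leq_exp_lg n) m_le
  k0 rk_inj out_le (ltnW kap_lt) kap_gt kap_le2 i4 i_le.
exists Bad; split=> // w /hBad [few size_lt].
have {}colors : lam * (nblocks lam i0 * block_deg lam kap i0) <= lam * kap + 10 * kap.
  by apply: leq_trans colors _; lia.
apply: good_seeds_mono (excess_ge lam_gt0 log_log_le colors) _.
pose bl v := block lam k0 i0 (w (pos v)).
(* One greedy coloring of the disjoint union of the blocks colors all of them at once. *)
pose eB : rel 'I_n := fun u v => e u v && (bl u == bl v).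
have [||v|chi [chi_lt chiP]] := @ordered_coloring _ eB rk (block_deg lam kap i0) rk_inj.
- by move=> u v; rewrite /eB e_sym eq_sym.
- by move=> u; rewrite /eB e_irr.
- apply: leq_ltn_trans (few v (bl v)); apply: subset_leq_card; apply/subsetP => u.
  by rewrite !inE /eB eq_sym => /andP [/andP [-> ->] ->].
have homeE v : layer_home i ([ffun v => w (pos v)] v) = nblocks lam i0 + bl v :> nat.
  by rewrite layer_homeE /layer_index leqNgt i4 /= ffunE.
have nb0 : 0 < nblocks lam i0 by rewrite expn_gt0.
have cap : block_deg lam kap i0 < color_cap n.
  by apply: leq_ltn_trans (small_cap colors); rewrite leq_pmull.
exists i, (fun q : 'I_n => if nblocks lam i0 <= q < nblocks lam i0 + nblocks lam i0
  then block_deg lam kap i0 else 0), chi; split.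
- move=> q; apply: (@nm_le _ n); last by rewrite leq_pmulr //; lia.
  apply: leq_trans loads.
  pose inq v := layer_home i ([ffun v => w (pos v)] v) == q.
  have -> : [set p : 'I_n * 'I_n | [&& e p.1 p.2, @home _ layered_scheme i ([ffun v => w (pos v)] p.1) == q,
      @home _ layered_scheme i ([ffun v => w (pos v)] p.2) == q &
      @clash _ layered_scheme i ([ffun v => w (pos v)] p.1) ([ffun v => w (pos v)] p.2)]] =
      [set p : 'I_n * 'I_n | e p.1 p.2 && (inq p.1 && inq p.2)].
    apply/setP => p; rewrite !inE /=; congr (_ && _).
    by rewrite /layer_clash /uses_lists /= (leqNgt i0) i4 !andbF andbT.
  apply: leq_trans (@card_edges_le _ e (fun u v => inq u && inq v) rk rk_inj e_sym e_irr _) _.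
    by move=> u v; apply: andbC.
  rewrite leq_mul2l /=.
  apply: (@leq_trans (\sum_(v | inq v) block_deg lam kap i0)).
    rewrite [X in _ <= X]big_mkcond /=; apply: leq_sum => v _.
    case qv: (inq v); last first.
      by rewrite (_ : [set _ in _ | _] = set0) ?cards0 //; apply/setP => u; rewrite !inE andbF.
    apply: leq_trans (ltnW (few v (bl v))); apply: subset_leq_card; apply/subsetP => u.
    rewrite !inE => /andP [-> /= uq].
    by move: qv uq; rewrite /inq => /eqP <- /eqP /(congr1 val) /=; rewrite !homeE => /addnI /eqP.
  rewrite sum_nat_const leq_mul2r; apply/orP; right.
  case: (pickP inq) => [v0 q0|none]; last by rewrite eq_card0.
  apply: leq_trans (ltnW (size_lt (bl v0))); apply: subset_leq_card; apply/subsetP => v vq.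
  have /eqP {}vq : inq v := vq; move/eqP: q0 => q0; rewrite inE.
  by move: vq; rewrite -q0 => /(congr1 val) /=; rewrite !homeE => /addnI /eqP.
- move=> v; have bl_lt : bl v < nblocks lam i0 by rewrite ltn_mod.
  rewrite /= homeE leq_addr ltn_add2l bl_lt; split=> //.
    exact: ltn_trans cap.
  by rewrite /layer_palette /uses_lists /= (leqNgt i0) i4 andbF.
- move=> u v euv /(congr1 val) /=; rewrite !homeE => /addnI buv; apply: chiP.
  by rewrite /eB euv buv eqxx.
- by move=> q; case: ifP => // _; apply: color_cap_gt0.
rewrite -big_mkcondr sum_nat_const leq_mul2r; apply/orP; right.
(* Injective on the leaders with a nonzero share, so there are at most [nblocks] of them; the
   default value is never taken there. *)
pose f (q : 'I_n) : 'I_(nblocks lam i0) := insubd (Ordinal nb0) (q - nblocks lam i0).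
rewrite -[X in _ <= X]card_ord -(card_in_imset (f := f)); first exact: max_card.
move=> q q'; rewrite !unfold_in => /andP [_ /andP [l1 l2]] /andP [_ /andP [l1' l2']].
move/(congr1 val); rewrite !val_insubd !ltn_subLR // l2 l2' => eqq.
by apply: val_inj => /=; lia.
Qed.

End Whp.

Lemma layered_whp (B : nat) (J : finType) (pos : 'I_n -> J) (e : rel 'I_n) :
  120 * (n * m) <= B -> injective pos -> symmetric e -> irreflexive e ->
  exists Bad : {set {ffun J -> T}}, #|Bad| * n <= #|{: {ffun J -> T}}| /\
  forall w, w \notin Bad -> good_seeds (Sc := layered_scheme) B e
    [ffun v => w (pos v)] (degeneracy e + excess (degeneracy e)).
Proof.
move=> hB pos_inj e_sym e_irr.
have [rk [rk_inj out_le]] := degenerate_order (degeneracyP e).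
have [i1|i1] := leqP (lg (degeneracy e)) lam.
  exists set0; rewrite cards0; split=> // w _.
  exact: (layered_whole hB e_sym e_irr rk_inj out_le).
have [i2|i2] := leqP (lg (degeneracy e)) (4 * lam).
  by apply: (layered_lists hB pos_inj e_sym e_irr rk_inj out_le); rewrite /uses_lists i1 i2.
exact: (layered_blocks hB pos_inj e_sym e_irr rk_inj out_le).
Qed.

End LayeredScheme.

Lemma quartic_le l : 32 <= l -> 400 * l ^ 4 <= 2 ^ l.
Proof.
(* The base case compares powers of 2, with [400 <= 2 ^ 9] and [32 ^ 4 = 2 ^ 20], which avoids
   evaluating large unary numbers. *)
elim: l => // l IH; rewrite leq_eqVlt => /orP [/eqP <-|l32].
  have pow32 : 32 ^ 4 = 2 ^ 20.
    transitivity ((2 ^ 5) ^ 4); first by congr (expn _ 4).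
    by rewrite -expnM; congr (expn 2 _).
  apply: (@leq_trans (2 ^ 9 * 32 ^ 4)); first by rewrite leq_mul2r; apply/orP; right.
  by rewrite pow32 -expnD; apply: leq_pexp2l.
have {}IH := IH l32; rewrite [2 ^ l.+1]expnS.
apply: leq_trans (leq_mul (leqnn 2) IH); rewrite mulnCA leq_mul2l; apply/orP; right.
(* The quartic grows by at most (9/8)^4 per step, which is less than 2. *)
have main : 8 * l.+1 <= 9 * l by lia.
have := leq_expn2r_weak 4 main; rewrite !expnMn => h.
have p0 : 0 < 8 ^ 4 by [].
rewrite -(leq_pmul2l p0); apply: leq_trans h _.
by rewrite mulnCA mulnA leq_mul2r orbT.
Qed.

(** * Assembly: small and large n *)

Definition solves_coloring (C n : nat) (A : mpc_algorithm n n 4) : Prop :=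
  forall e : rel 'I_n, symmetric e -> irreflexive e ->
  forall inp : 'I_n -> seq ('I_n * 'I_n), edge_distribution e inp ->
    (forall q : 'I_n, size (edges_code (inp q)) <= memory_bits C n) ->
    within_memory A inp (memory_bits C n) /\
    (1 - (n%:R ^+ 1)^-1 <=
       mpc_probability (outputs_proper_coloring (A := A) inp e
         (degeneracy e + excess (degeneracy e))))%R.

Lemma protocol_solves n (Sc : scheme n) (B cB C : nat) :
  1 < n -> seed_len Sc <= lg n ^ 2 -> scales Sc <= (lg n).+1 ->
  B <= cB * (n * lg n) -> cB + 40 <= C ->
  (forall e : rel 'I_n, symmetric e -> irreflexive e ->
    exists Bad : {set coins (protocol Sc B)},
      #|Bad| * n <= #|{: coins (protocol Sc B)}| /\
      forall w, w \notin Bad -> good_seeds B e (drawn w)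
        (degeneracy e + excess (degeneracy e))) ->
  solves_coloring C (protocol Sc B).
Proof.
move=> n1 hL hS hB hC whp e e_sym e_irr inp inpP inp_le; split.
  by move=> w; split=> [t q|r q]; [apply: view_le|apply: sent_le]; eassumption.
have [Bad [cBad good]] := whp e e_sym e_irr.
rewrite /mpc_probability expr1; set E := [set w | _].
have sub : #|~: Bad| <= #|E|.
  apply: subset_leq_card; apply/subsetP => w; rewrite !inE => wB.
  by apply: (protocol_correct n1 inpP); apply: good.
have tot : #|Bad| + #|~: Bad| = #|{: coins (protocol Sc B)}| := cardsC Bad.
have O0 : 0 < #|{: coins (protocol Sc B)}|.
  by rewrite card_ffun expn_gt0 card_tuple expn_gt0 card_bool.
have O0r : (0 < #|{: coins (protocol Sc B)}|%:R :> rat)%R by rewrite ltr0n.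
have n0r : (0 < n%:R :> rat)%R by rewrite ltr0n; lia.
rewrite ler_pdivlMr // mulrBl mul1r lerBlDr.
apply: (@le_trans _ _ (#|E|%:R + #|Bad|%:R)%R).
  by rewrite -natrD ler_nat -tot addnC leq_add2r.
by rewrite lerD2l mulrC ler_pdivlMr // -natrM ler_nat.
Qed.

(** For [n <= 1] the memory bound is 0, so nothing may be kept or sent. With one vertex the required
    probability is 0; with none the empty coloring is output. *)
Definition idle n : mpc_algorithm n n 4 :=
  @MPCAlgorithm n n 4 0 (fun _ _ _ _ => ([::], fun=> [::])) (fun _ _ _ => None).

Lemma idle_solves C n : n <= 1 -> solves_coloring C (idle n).
Proof.
move=> n1 e e_sym e_irr inp inpP inp_le; split.
  move=> w; have sent (r : 'I_4) q x u : (local_result w r x q).2 u = [::] by [].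
  split=> [t q t4|r q]; last by rewrite /total_size big1.
  case: t t4 => [|t] t4.
    by rewrite /config_at take0 /view_size /= /total_size big1 ?addn0.
  by rewrite (config_atS inp w t4) /view_size /= /total_size big1.
case: n n1 e e_sym e_irr inp inpP inp_le => [|[|//]] _ e e_sym e_irr inp inpP inp_le.
  rewrite expr1 invr0 subr0 /mpc_probability (_ : [set w | _] = setT).
    rewrite cardsT divff // pnatr_eq0 -lt0n card_ffun card_tuple card_bool.
    by rewrite !expn_gt0.
  apply/setP => w; rewrite !inE; apply/existsP.
  have chi : {ffun 'I_0 -> 'I_(degeneracy e + excess (degeneracy e))}.
    by apply: finfun => -[].
  by exists chi; apply/andP; split; apply/forallP => -[].
by rewrite expr1 invr1 subrr divr_ge0 ?ler0n.
Qed.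

(** For [n <= N0] the whole graph has at most [n * N0] edges, which the constant [cB] absorbs. The
    algorithm comes in a sigma type, so the family over all [n] is obtained by projection. *)
Lemma coloring_algorithm N0 n : (~~ (32 <= lg (lg n)) -> n <= N0) ->
  {A : mpc_algorithm n n 4 | solves_coloring (2 * N0 + 160) A}.
Proof.
case: n => [|n'] hN; first by exists (idle 0); apply: idle_solves.
have [n1|n1] := boolP (1 < n'.+1); last first.
  by exists (idle n'.+1); apply: idle_solves; rewrite leqNgt.
pose cB := 2 * N0 + 120; pose B := cB * (n'.+1 * lg n'.+1).
have lg0 := lg_gt0 n1.
have [big|small] := boolP (32 <= lg (lg n'.+1)).
  have lam0 : 0 < lg (lg n'.+1) by apply: leq_trans big.
  have lam_big := quartic_le big.
  exists (protocol (layered_scheme lam0 lam_big) B).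
  apply: (@protocol_solves _ _ B cB) => //.
  - exact: seed_len_layered.
  - by rewrite /cB; lia.
  move=> e e_sym e_irr.
  have pos_inj : injective (fun v : 'I_n'.+1 => (ord0 : 'I_4, v)) by move=> u v [].
  have hB : 120 * (n'.+1 * lg n'.+1) <= B by rewrite leq_mul2r /cB; lia.
  exact: (layered_whp lam0 lam_big hB pos_inj e_sym e_irr).
exists (protocol (whole_scheme n') B).
apply: (@protocol_solves _ _ B cB) => //; first by rewrite /cB; lia.
move=> e e_sym e_irr; exists set0; rewrite cards0; split=> // w _.
have [rk [rk_inj out_le]] := degenerate_order (degeneracyP e).
have kap_lt : degeneracy e < n'.+1.
  by have := degeneracy_le e_irr; rewrite card_ord.
apply: (@good_seeds_mono _ _ _ _ _ (degeneracy e).+1).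
  by rewrite /excess addnA addn1 ltnS leq_addr.
apply: (@good_whole_graph _ (whole_scheme n') B e n1 e_sym e_irr _ ord0 ord0 _ _ rk) => //.
apply: (@leq_trans (2 * (n'.+1 * N0))).
  by rewrite !leq_mul2l /= (leq_trans (ltnW kap_lt) (hN small)).
apply: (@leq_trans (cB * n'.+1)); last by rewrite leq_mul2l leq_pmulr ?orbT.
by rewrite mulnCA mulnC leq_mul2r /cB leq_addr orbT.
Qed.

Theorem theorem4p3 :
  exists (R C c : nat) (f : nat -> nat) (A : forall n : nat, mpc_algorithm n n R),
    [/\ 0 < C, 0 < c, little_o_id f &
        forall (n : nat) (e : rel 'I_n), symmetric e -> irreflexive e ->
        forall inp : 'I_n -> seq ('I_n * 'I_n),
          edge_distribution e inp ->
          (forall q : 'I_n, size (edges_code (inp q)) <= memory_bits C n) ->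
          within_memory (A n) inp (memory_bits C n) /\
          (1 - (n%:R ^+ c)^-1 <=
             mpc_probability (outputs_proper_coloring (A := A n) inp e
               (degeneracy e + f (degeneracy e))))%R].
Proof.
(* The threshold is hidden behind an existential, so that this astronomic numeral is never
   evaluated. *)
have [N0 hN0] : exists N0, forall n, ~~ (32 <= lg (lg n)) -> n <= N0.
  exists (2 ^ (2 ^ 32)) => n; rewrite -ltnNge => small.
  apply: leq_trans (leq_exp_lg n) _; apply: leq_pexp2l => //.
  by apply: leq_trans (leq_exp_lg (lg n)) _; apply: leq_pexp2l => //; apply: ltnW.
pose A n := coloring_algorithm (hN0 n).
exists 4, (2 * N0 + 160), 1, excess, (fun n => sval (A n)); split=> //.
- by rewrite addn_gt0 orbT.
- exact: excess_little_o.
by move=> n e e_sym e_irr inp; apply: (svalP (A n)).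
Qed.
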